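(* Let $p>3$ and $\theta\notin\{1-q,\,1+q/2\}$. If there exists $m\in\{1,2,\dots,[q/2]\}$ such that $$\max\left\{\left|\frac{\theta-1}{m}\right|_p,\left|\frac{q}{m}\right|_p\right\}\le p^{-3},$$ then there exist at least $1+3\binom{q}{m}$ translation-invariant $p$-adic Gibbs measures (TIpGMs) for the $q$-state $p$-adic Potts model on the Cayley tree of order three.
   Context: $p$ is a prime, $\mathbb Q_p$ the field of $p$-adic numbers with norm $|\cdot|_p$; $[a]$ is the integer part of $a$. Cayley tree: $\Gamma^k=(V,L)$ is the infinite tree in which every vertex has exactly $k+1$ neighbours (here $k=3$); $x^0\in V$ is a fixed root, $d$ the graph distance, $W_n=\{x\in V:d(x,x^0)=n\}$, $V_n=\bigcup_{j=0}^nW_j$. Potts model: spins take values in $\Phi=\{1,\dots,q\}$, $q\ge2$; the Hamiltonian is $H(\sigma)=J\sum_{\langle x,y\rangle\in L}\delta_{\sigma(x)\sigma(y)}$ with $J\in\mathbb Q_p$, $|J|_p<p^{-1/(p-1)}$, and $\theta=\exp_p(J)$. $H_n$ is the restriction of $H$ to $V_n$. $p$-adic Gibbs measure: a $p$-adic measure is a finitely additive $\mathbb Q_p$-valued function on an algebra of sets; it is a probability measure if the total mass is $1$. Given vectors $\tilde h_x=(\tilde h_{1,x},\dots,\tilde h_{q,x})\in\mathbb Q_p^q$, $x\in V$ (with entries in the domain of convergence of $\exp_p$), put $$\mu^{(n)}_{\tilde h}(\sigma_n)=Z_{n,\tilde h}^{-1}\exp_p\Big\{H_n(\sigma_n)+\sum_{x\in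 W_n}\tilde h_{\sigma_n(x),x}\Big\},\qquad \sigma_n\in\Phi^{V_n},$$ where $Z_{n,\tilde h}$ is the (nonzero) normalizing factor. If these are compatible, i.e. $\sum_{\omega_n\in\Phi^{W_n}}\mu^{(n)}_{\tilde h}(\sigma_{n-1}\vee\omega_n)=\mu^{(n-1)}_{\tilde h}(\sigma_{n-1})$ for all $n\ge1$ and $\sigma_{n-1}\in\Phi^{V_{n-1}}$ ($\vee$ is concatenation), they define a unique $p$-adic probability measure $\mu_{\tilde h}$ on the algebra of cylinder sets of $\Phi^V$, called a $p$-adic Gibbs measure. It is translation-invariant (a TIpGM) if the reduced vectors $h_x=(\tilde h_{i,x}-\tilde h_{q,x})_{i=1}^{q-1}$ do not depend on $x\in V$.
   Formalization: The formal statement assumes J≠0 (at J=0 there is only one Gibbs measure), and requires the exponential formula and compatibility only on balls V_n, n≥1, not at the root V_0, where the 4 successors would force every TIpGM to be the uniform one. *)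

(* Defs.v *)
From HB Require Import structures.
From mathcomp Require Import all_boot all_order all_algebra.
From mathcomp Require Import all_classical all_reals all_analysis.
From mathcomp Require Import ring.
Set Implicit Arguments.
Unset Strict Implicit.
Unset Printing Implicit Defensive.
Import Order.TTheory GRing.Theory Num.Theory.
Local Open Scope classical_set_scope.
Local Open Scope ring_scope.
Local Open Scope quotient_scope.

(* logn p `|numq x| - logn p `|denq x| is the p-adic valuation of x != 0 *)
Definition rat_padic_norm (p : nat) (x : rat) : rat :=
  if x == 0 then 0
  else (p%:R : rat) ^ ((logn p `|denq x|)%:Z - (logn p `|numq x|)%:Z).

Section RatPadicNorm.
Variables (p : nat) (p_pr : prime p).
Local Notation N := (rat_padic_norm p).

Let p_gt0 : 0 < (p%:R : rat).
Proof. by rewrite ltr0n prime_gt0. Qed.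

Let p_neq0 : (p%:R : rat) != 0. Proof. by rewrite gt_eqF. Qed.

Lemma rat_padic_norm0 : N 0 = 0.
Proof. by rewrite /rat_padic_norm eqxx. Qed.

Lemma rat_padic_norm_gt0 x : x != 0 -> 0 < N x.
Proof. by move=> /negPf x0; rewrite /rat_padic_norm x0 exprz_gt0. Qed.

Lemma rat_padic_norm_ge0 x : 0 <= N x.
Proof.
have [->|/rat_padic_norm_gt0/ltW//] := eqVneq x 0.
by rewrite rat_padic_norm0.
Qed.

Lemma rat_padic_norm_eq0 x : (N x == 0) = (x == 0).
Proof.
have [->|x0] := eqVneq x 0; first by rewrite rat_padic_norm0 eqxx.
by rewrite gt_eqF ?rat_padic_norm_gt0.
Qed.

Lemma rat_padic_norm_frac (a b : int) : a != 0 -> b != 0 ->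
  N (a%:~R / b%:~R) = (p%:R : rat) ^ ((logn p `|b|)%:Z - (logn p `|a|)%:Z).
Proof.
move=> a0 b0; set x := _ / _.
have lognMz (c d : int) : c != 0 -> d != 0 ->
    logn p `|c * d| = (logn p `|c| + logn p `|d|)%N.
  by move=> c0 d0; rewrite abszM lognM // absz_gt0.
have x0 : x != 0 by rewrite mulf_neq0 ?invr_eq0 ?intr_eq0.
rewrite /rat_padic_norm (negPf x0); congr (_ ^ _).
have : a * denq x = numq x * b.
  apply/eqP; rewrite -(eqr_int rat) !intrM numqE /x mulrAC divfK //.
  by rewrite intr_eq0.
move=> /(congr1 (fun z : int => logn p `|z|)).
rewrite !lognMz ?denq_neq0 ?numq_eq0 // => e.
apply/eqP; rewrite subr_eq addrAC eq_sym subr_eq -!PoszD.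
by rewrite eqz_nat addnC -e addnC.
Qed.

Let frac2 (x y : rat) : exists a b c : int,
  [/\ c != 0, x = a%:~R / c%:~R & y = b%:~R / c%:~R].
Proof.
exists (numq x * denq y), (numq y * denq x), (denq x * denq y).
have dx : (denq x)%:~R != 0 :> rat by rewrite intr_eq0 denq_neq0.
have dy : (denq y)%:~R != 0 :> rat by rewrite intr_eq0 denq_neq0.
rewrite mulf_neq0 ?denq_neq0 //; split=> //; rewrite !intrM numqE; by field; rewrite dx dy.
Qed.

Lemma rat_padic_normM x y : N (x * y) = N x * N y.
Proof.
have [->|x0] := eqVneq x 0; first by rewrite mul0r rat_padic_norm0 mul0r.
have [->|y0] := eqVneq y 0; first by rewrite mulr0 rat_padic_norm0 mulr0.
have [a [b [c [c0 ex ey]]]] := frac2 x y.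
have a0 : a != 0.
  by apply: contraNneq x0 => a0; rewrite ex a0 mul0r.
have b0 : b != 0.
  by apply: contraNneq y0 => b0; rewrite ey b0 mul0r.
rewrite [in LHS]ex [in LHS]ey mulf_div -!intrM ex ey.
rewrite !rat_padic_norm_frac ?mulf_neq0 // -expfzDr //; congr (_ ^ _).
rewrite !abszM !lognM ?absz_gt0 // !PoszD; ring.
Qed.

Lemma rat_padic_norm1 : N 1 = 1.
Proof. by rewrite /rat_padic_norm oner_eq0 /= subrr expr0z. Qed.

Lemma rat_padic_normN x : N (- x) = N x.
Proof.
rewrite -mulN1r rat_padic_normM.
suff -> : N (-1) = 1 by rewrite mul1r.
have : N (-1) * N (-1) = 1 by rewrite -rat_padic_normM mulrNN mulr1 rat_padic_norm1.
move/eqP; rewrite -expr2 sqrf_eq1 => /orP[/eqP//|/eqP e].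
by have := rat_padic_norm_ge0 (-1); rewrite e oppr_ge0 ler10.
Qed.

Lemma rat_padic_normV x : N x^-1 = (N x)^-1.
Proof.
have [->|x0] := eqVneq x 0; first by rewrite invr0 rat_padic_norm0 ?invr0.
have Nx : N x != 0 by rewrite rat_padic_norm_eq0.
by apply: (mulIf Nx); rewrite -rat_padic_normM !mulVf // rat_padic_norm1.
Qed.

Lemma rat_padic_normD x y : N (x + y) <= Num.max (N x) (N y).
Proof.
have [->|x0] := eqVneq x 0; first by rewrite add0r le_max lexx orbT.
have [->|y0] := eqVneq y 0; first by rewrite addr0 le_max lexx.
have [->|xy0] := eqVneq (x + y) 0.
  by rewrite rat_padic_norm0 le_max rat_padic_norm_ge0.
have [a [b [c [c0 ex ey]]]] := frac2 x y.
have a0 : a != 0.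
  by apply: contraNneq x0 => a0; rewrite ex a0 mul0r.
have b0 : b != 0.
  by apply: contraNneq y0 => b0; rewrite ey b0 mul0r.
have exy : x + y = (a + b)%:~R / c%:~R by rewrite ex ey intrD mulrDl.
have ab0 : a + b != 0.
  by apply: contraNneq xy0 => ab0; rewrite exy ab0 mul0r.
rewrite exy ex ey !rat_padic_norm_frac // le_max.
have p1 : 1 < (p%:R : rat) by rewrite ltr1n prime_gt1.
rewrite !ler_eXz2l // !lerD2l !lerN2 !lez_nat -!pfactor_dvdn ?absz_gt0 //.
have dv (k : nat) (z : int) : (k %| `|z|)%N = (k%:Z %| z)%Z by rewrite dvdzE.
have [le|/ltnW le] := leqP (logn p `|a|) (logn p `|b|); apply/orP; [left|right].
  rewrite dv rpredD // -[_ \in _]dv ?pfactor_dvdnn //.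
  by rewrite (dvdn_trans (dvdn_exp2l p le)) // pfactor_dvdnn.
rewrite dv rpredD // -[_ \in _]dv ?pfactor_dvdnn //.
by rewrite (dvdn_trans (dvdn_exp2l p le)) // pfactor_dvdnn.
Qed.

Lemma rat_padic_norm_eq x y : N (x - y) < N y -> N x = N y.
Proof.
move=> h; apply/eqP; rewrite eq_le; apply/andP; split.
  rewrite -{1}(subrK y x) (le_trans (rat_padic_normD _ _)) // ge_max lexx andbT.
  exact: ltW.
have := rat_padic_normD (y - x) x; rewrite subrK le_max => /orP[|//].
by rewrite -(rat_padic_normN (y - x)) opprB leNgt h.
Qed.

End RatPadicNorm.

Section PadicField.
Variables (p : nat) (p_pr : prime p).
Local Notation N := (rat_padic_norm p).

Definition padic_cauchy : set (nat -> rat) :=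
  [set u | forall e : rat, 0 < e -> exists n0, forall i j,
    (n0 <= i)%N -> (n0 <= j)%N -> N (u i - u j) < e].

Definition padic_null : set (nat -> rat) :=
  [set u | forall e : rat, 0 < e -> exists n0, forall i, (n0 <= i)%N -> N (u i) < e].

(* the primality proof is only there to key the canonical structures *)
Definition padic_cauchyb (_ : prime p) : {pred (nat -> rat)} := fun u => `[< padic_cauchy u >].

Lemma padic_cauchy_bounded u : padic_cauchy u ->
  exists n0, exists2 B : rat, 0 < B & forall i, (n0 <= i)%N -> N (u i) <= B.
Proof.
move=> /(_ 1 ltr01)[n0 h]; exists n0, (1 + N (u n0)).
  by rewrite (lt_le_trans ltr01) // lerDl rat_padic_norm_ge0.
move=> i hi; rewrite -(subrK (u n0) (u i)) (le_trans (rat_padic_normD p_pr _ _)) //.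
rewrite ge_max lerDr ler01 andbT (le_trans (ltW (h _ _ hi (leqnn _)))) //.
by rewrite lerDl rat_padic_norm_ge0.
Qed.

Lemma rat_padic_norm_prod_small (x y x' y' B C e : rat) : 0 < B -> 0 < C ->
  N x <= B -> N y' <= C -> N (x - x') < e / C -> N (y - y') < e / B ->
  N (x * y - x' * y') < e.
Proof.
move=> B0 C0 xB yC dx dy.
have -> : x * y - x' * y' = x * (y - y') + (x - x') * y' by ring.
rewrite (le_lt_trans (rat_padic_normD p_pr _ _)) // gt_max !(rat_padic_normM p_pr).
apply/andP; split.
  rewrite (le_lt_trans (y := B * N (y - y'))) ?ler_wpM2r ?rat_padic_norm_ge0 //.
  by rewrite mulrC -ltr_pdivlMr.
rewrite (le_lt_trans (y := N (x - x') * C)) ?ler_wpM2l ?rat_padic_norm_ge0 //.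
by rewrite -ltr_pdivlMr.
Qed.

Local Notation cauchyb := (padic_cauchyb p_pr).

Fact padic_cauchy_subring : subring_closed cauchyb.
Proof.
split.
- apply/asboolP => e e0; exists 0%N => i j _ _.
  by rewrite subrr rat_padic_norm0.
- move=> u v /asboolP cu /asboolP cv; apply/asboolP => e e0.
  have [n1 h1] := cu _ e0; have [n2 h2] := cv _ e0.
  exists (maxn n1 n2) => i j; rewrite !geq_max => /andP[i1 i2] /andP[j1 j2].
  have -> : (u - v) i - (u - v) j = (u i - u j) - (v i - v j).
    by rewrite !fctE; ring.
  rewrite (le_lt_trans (rat_padic_normD p_pr _ _)) // gt_max h1 //=.
  by rewrite rat_padic_normN // h2.
- move=> u v /asboolP cu /asboolP cv; apply/asboolP => e e0.
  have [n1 [B B0 h1]] := padic_cauchy_bounded cu; have [n2 [C C0 h2]] := padic_cauchy_bounded cv.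
  have [n3 h3] := cu _ (divr_gt0 e0 C0); have [n4 h4] := cv _ (divr_gt0 e0 B0).
  exists (maxn (maxn n1 n2) (maxn n3 n4)) => i j; rewrite !geq_max.
  move=> /andP[/andP[i1 i2] /andP[i3 i4]] /andP[/andP[j1 j2] /andP[j3 j4]].
  by apply: (rat_padic_norm_prod_small B0 C0); [exact: h1|exact: h2|exact: h3|exact: h4].
Qed.

HB.instance Definition _ :=
  GRing.isSubringClosed.Build (nat -> rat) cauchyb padic_cauchy_subring.

Record padic_seq := PadicSeq {
  padic_seq_val :> nat -> rat; padic_seq_valP : padic_seq_val \in cauchyb }.
HB.instance Definition _ := [isSub for padic_seq_val].
HB.instance Definition _ := [Choice of padic_seq by <:].
HB.instance Definition _ := [SubChoice_isSubComNzRing of padic_seq by <:].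

Definition padic_nullb : {pred padic_seq} := fun u => `[< padic_null u >].

Fact padic_null_idealr : idealr_closed padic_nullb.
Proof.
split.
- by apply/asboolP => e e0; exists 0%N => i _; rewrite rat_padic_norm0.
- apply/asboolP => /(_ 1 ltr01)[n0 /(_ _ (leqnn _))].
  by rewrite rat_padic_norm1 ltxx.
- move=> a u v /asboolP nu /asboolP nv; apply/asboolP => e e0.
  have [n1 [B B0 h1]] := padic_cauchy_bounded (asboolW (padic_seq_valP a)).
  have [n2 h2] := nu _ (divr_gt0 e0 B0); have [n3 h3] := nv _ e0.
  exists (maxn n1 (maxn n2 n3)) => i; rewrite !geq_max => /and3P[i1 i2 i3].
  rewrite (le_lt_trans (rat_padic_normD p_pr _ _)) // gt_max h3 // andbT.
  rewrite rat_padic_normM // (le_lt_trans (y := B * N (u i))) //.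
    by rewrite ler_wpM2r ?rat_padic_norm_ge0 // h1.
  by rewrite mulrC -ltr_pdivlMr // h2.
Qed.

HB.instance Definition _ := isIdealr.Build padic_seq padic_nullb padic_null_idealr.

(* Q_p: Cauchy sequences of rationals modulo null sequences, both taken with
   respect to |.|_p *)
Definition padic := {ideal_quot padic_nullb}.
HB.instance Definition _ := GRing.ComNzRing.on padic.
HB.instance Definition _ : EqQuotient padic_seq (Quotient.equiv padic_nullb) padic :=
  EqQuotient.on padic.


Local Notation P := (\pi_padic).

Lemma padic_pi_surj (x : padic) : exists u, P u = x.
Proof. by exists (repr x); rewrite reprK. Qed.

Lemma padic_pi_eq0 u : (P u == 0 :> padic) = (u \in padic_nullb).
Proof.
by rewrite -[0 in LHS](@pi_zeror _ _ _ _ _ padic) -Quotient.idealrBE subr0.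
Qed.

Lemma padic_seq_cauchy (u : padic_seq) : padic_cauchy u.
Proof. exact: asboolW (padic_seq_valP u). Qed.

Lemma padic_seq_norm_const (u : padic_seq) : u \notin padic_nullb ->
  exists r n0, 0 < r /\ forall i, (n0 <= i)%N -> N (u i) = r.
Proof.
move=> nu.
have [e e0 he] : exists2 e : rat, 0 < e &
    forall n0, exists2 i, (n0 <= i)%N & e <= N (u i).
  apply: contrapT => /forall2NP h; move/negP: nu; apply; apply/asboolP => e e0.
  have [//|/existsNP[n0 /forall2NP hn]] := h e.
  by exists n0 => i i0; have [//|/negP] := hn i; rewrite -ltNge.
have [n0 h] := padic_seq_cauchy u e0; have [i0 i0n ei] := he n0.
exists (N (u i0)), n0; split; first exact: lt_le_trans ei.
by move=> i hi; apply: rat_padic_norm_eq => //; apply: lt_le_trans ei; apply: h.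
Qed.

Definition padic_seqV (u : padic_seq) : padic_seq := insubd u (fun i => (u i)^-1).

Lemma padic_seqVE (u : padic_seq) : u \notin padic_nullb ->
  padic_seqV u = (fun i => (u i)^-1) :> (nat -> rat).
Proof.
move=> nu; rewrite /padic_seqV /= insubdK //; apply/asboolP => e e0.
have [r [n0 [r0 hr]]] := padic_seq_norm_const nu.
have [n1 h1] := padic_seq_cauchy u (mulr_gt0 e0 (mulr_gt0 r0 r0)).
exists (maxn n0 n1) => i j; rewrite !geq_max => /andP[i0 i1] /andP[j0 j1].
have ui : u i != 0 by rewrite -(rat_padic_norm_eq0 p_pr) hr // gt_eqF.
have uj : u j != 0 by rewrite -(rat_padic_norm_eq0 p_pr) hr // gt_eqF.
have -> : (u i)^-1 - (u j)^-1 = (u j - u i) / (u i * u j).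
  by field; rewrite ui uj.
rewrite !(rat_padic_normM p_pr, rat_padic_normV p_pr) !hr //.
by rewrite ltr_pdivrMr ?mulr_gt0 // h1.
Qed.

Definition padic_inv (x : padic) : padic :=
  if x == 0 then 0 else P (padic_seqV (repr x)).

Fact padic_mulVf x : x != 0 -> padic_inv x * x = 1.
Proof.
move=> x0; rewrite /padic_inv (negPf x0).
have nu : repr x \notin padic_nullb by rewrite -padic_pi_eq0 reprK.
rewrite -[X in _ * X]reprK -(@pi_mulr _ _ _ _ _ _ _ padic).
rewrite -(@pi_oner _ _ _ _ _ _ _ padic); apply/eqP; rewrite -Quotient.idealrBE.
apply/asboolP => e e0.
have [r [n0 [r0 hr]]] := padic_seq_norm_const nu.
exists n0 => i hi /=; rewrite /= !fctE padic_seqVE // mulVf.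
  by rewrite subrr rat_padic_norm0.
by rewrite -(rat_padic_norm_eq0 p_pr) hr // gt_eqF.
Qed.

Fact padic_inv0 : padic_inv 0 = 0.
Proof. by rewrite /padic_inv eqxx. Qed.

HB.instance Definition _ :=
  GRing.ComNzRing_isField.Build padic padic_mulVf padic_inv0.

(* limit of the norms of a representative; it is a rational number because
   |.|_p on Q_p takes its values in {0} U p^Z *)
Definition padic_norm (x : padic) : rat := xget 0
  [set r | forall e : rat, 0 < e ->
     exists n0, forall i, (n0 <= i)%N -> `|N (repr x i) - r| < e].

Lemma rat_lim_unique (a : nat -> rat) r s :
  (forall e : rat, 0 < e -> exists n0, forall i, (n0 <= i)%N -> `|a i - r| < e) ->
  (forall e : rat, 0 < e -> exists n0, forall i, (n0 <= i)%N -> `|a i - s| < e) ->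
  r = s.
Proof.
move=> hr hs; apply/eqP/negPn/negP => rs.
have e0 : 0 < `|r - s| / 2 by rewrite divr_gt0 // normr_gt0 subr_eq0.
have [n1 h1] := hr _ e0; have [n2 h2] := hs _ e0.
have l1 := h1 _ (leq_maxl n1 n2); have l2 := h2 _ (leq_maxr n1 n2).
have := ltrD l1 l2; rewrite -splitr (distrC _ r) ltNge.
by move/negP; apply; rewrite -(subrKA (a (maxn n1 n2)) r (- s)) ler_normD.
Qed.

Lemma padic_norm_unique (x : padic) r :
  (forall e : rat, 0 < e ->
     exists n0, forall i, (n0 <= i)%N -> `|N (repr x i) - r| < e) ->
  padic_norm x = r.
Proof. by move=> xr; apply: xget_unique => //= s xs; exact: rat_lim_unique xs xr. Qed.

Lemma padic_norm0 : padic_norm 0 = 0.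
Proof.
apply: padic_norm_unique => e e0.
have : repr (0 : padic) \in padic_nullb by rewrite -padic_pi_eq0 reprK.
move=> /asboolP/(_ e e0)[n0 h]; exists n0 => i /h.
by rewrite subr0 ger0_norm ?rat_padic_norm_ge0.
Qed.

Lemma padic_norm_pi u : P u != 0 ->
  exists n0, forall i, (n0 <= i)%N -> N (u i) = padic_norm (P u).
Proof.
move=> u0; have nu : repr (P u) \notin padic_nullb by rewrite -padic_pi_eq0 reprK.
have [r [n0 [r0 hr]]] := padic_seq_norm_const nu.
have -> : padic_norm (P u) = r.
  apply: padic_norm_unique => e e0; exists n0 => i /hr ->.
  by rewrite subrr normr0.
have /asboolP/(_ r r0)[n1 h1] : u - repr (P u) \in padic_nullb.
  by rewrite Quotient.idealrBE reprK.
exists (maxn n0 n1) => i; rewrite geq_max => /andP[/hr hi /h1 i1].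
by rewrite -hi; apply: rat_padic_norm_eq => //; rewrite hi.
Qed.

Lemma padic_norm_ge0 x : 0 <= padic_norm x.
Proof.
have [->|] := eqVneq x 0; first by rewrite padic_norm0.
have [u <-] := padic_pi_surj x => /padic_norm_pi[n0 /(_ n0 (leqnn _)) <-].
exact: rat_padic_norm_ge0.
Qed.

Lemma padic_norm_eq0 x : (padic_norm x == 0) = (x == 0).
Proof.
have [->|x0] := eqVneq x 0; first by rewrite padic_norm0 eqxx.
have [r [n0 [r0 hr]]] : exists r n0, 0 < r /\ forall i, (n0 <= i)%N -> N (repr x i) = r.
  by apply: padic_seq_norm_const; rewrite -padic_pi_eq0 reprK.
rewrite (_ : padic_norm x = r) ?gt_eqF //.
by apply: padic_norm_unique => e e0; exists n0 => i /hr ->; rewrite subrr normr0.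
Qed.

Lemma padic_normM x y : padic_norm (x * y) = padic_norm x * padic_norm y.
Proof.
have [->|x0] := eqVneq x 0; first by rewrite mul0r padic_norm0 mul0r.
have [->|y0] := eqVneq y 0; first by rewrite mulr0 padic_norm0 mulr0.
have : x * y != 0 by rewrite mulf_neq0.
have [u ux] := padic_pi_surj x; have [v vy] := padic_pi_surj y; move: x0 y0.
rewrite -ux -vy -(@pi_mulr _ _ _ _ _ _ _ padic).
move=> /padic_norm_pi[n1 h1] /padic_norm_pi[n2 h2] /padic_norm_pi[n3 h3].
pose i := maxn n1 (maxn n2 n3).
rewrite -(h1 i) -?(h2 i) -?(h3 i) ?rat_padic_normM // /i.
all: by rewrite !leq_max leqnn ?orbT.
Qed.

Lemma padic_normD x y :
  padic_norm (x + y) <= Num.max (padic_norm x) (padic_norm y).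
Proof.
have [->|x0] := eqVneq x 0; first by rewrite add0r le_max lexx orbT.
have [->|y0] := eqVneq y 0; first by rewrite addr0 le_max lexx.
have [->|] := eqVneq (x + y) 0.
  by rewrite padic_norm0 le_max padic_norm_ge0.
have [u ux] := padic_pi_surj x; have [v vy] := padic_pi_surj y; move: x0 y0.
rewrite -ux -vy -(@pi_addr _ _ _ _ _ padic).
move=> /padic_norm_pi[n1 h1] /padic_norm_pi[n2 h2] /padic_norm_pi[n3 h3].
pose i := maxn n1 (maxn n2 n3).
rewrite -(h1 i) -?(h2 i) -?(h3 i) ?rat_padic_normD // /i.
all: by rewrite !leq_max leqnn ?orbT.
Qed.

Lemma padic_norm1 : padic_norm 1 = 1.
Proof.
have n1 : padic_norm 1 != 0 by rewrite padic_norm_eq0 oner_eq0.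
by apply: (mulfI n1); rewrite -padic_normM !mulr1.
Qed.

Lemma padic_normN x : padic_norm (- x) = padic_norm x.
Proof.
rewrite -mulN1r padic_normM.
suff -> : padic_norm (-1) = 1 by rewrite mul1r.
have : padic_norm (-1) * padic_norm (-1) = 1.
  by rewrite -padic_normM mulrNN mulr1 padic_norm1.
move/eqP; rewrite -expr2 sqrf_eq1 => /orP[/eqP//|/eqP e].
by have := padic_norm_ge0 (-1); rewrite e oppr_ge0 ler10.
Qed.

Lemma padic_norm_nat n : padic_norm n%:R = N n%:R.
Proof.
have pin : P n%:R = n%:R :> padic.
  elim: n => [|n IH]; first by rewrite (@pi_zeror _ _ _ _ _ padic).
  by rewrite !mulrS (@pi_addr _ _ _ _ _ padic) IH (@pi_oner _ _ _ _ _ _ _ padic).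
have vn i : padic_seq_val (n%:R : padic_seq) i = n%:R.
  by elim: n {pin} => [//|n IH]; rewrite !mulrS -IH.
have [->|n0] := eqVneq n 0; first by rewrite padic_norm0 rat_padic_norm0.
have : P n%:R != 0 :> padic.
  rewrite padic_pi_eq0; apply/asboolP => /(_ (N n%:R)).
  rewrite rat_padic_norm_gt0 ?pnatr_eq0 // => /(_ isT)[k /(_ k (leqnn _))].
  by rewrite vn ltxx.
by rewrite -pin => /padic_norm_pi[k /(_ k (leqnn _)) <-]; rewrite vn.
Qed.

Definition padic_dist (x y : padic) : rat := padic_norm (x - y).

Fact padic_distxx x : padic_dist x x = 0.
Proof. by rewrite /padic_dist subrr padic_norm0. Qed.

Fact padic_dist_positivity x y : padic_dist x y = 0 -> x = y.
Proof. by move/eqP; rewrite padic_norm_eq0 subr_eq0 => /eqP. Qed.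

Fact padic_distC x y : padic_dist x y = padic_dist y x.
Proof. by rewrite /padic_dist -padic_normN opprB. Qed.

Fact padic_dist_triangle y x z :
  padic_dist x z <= padic_dist x y + padic_dist y z.
Proof.
rewrite /padic_dist -(subrKA y) (le_trans (padic_normD _ _)) //.
by rewrite ge_max lerDl lerDr !padic_norm_ge0.
Qed.

HB.instance Definition _ := isMetric.Build rat padic
  padic_distxx padic_dist_positivity padic_distC padic_dist_triangle.
HB.instance Definition _ := isPointed.Build padic 0.

End PadicField.

Section PadicExp.
Variables (p : nat) (p_pr : prime p).

Definition padic_exp (x : padic p_pr) : padic p_pr :=
  lim (series (fun n => x ^+ n / n`!%:R) @ \oo).

(* |x|_p < p^(-1/(p-1)), the disc of convergence of padic_exp, with both
   sides raised to the power p - 1 since the norm is rational-valued *)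
Definition in_exp_domain (x : padic p_pr) : Prop :=
  padic_norm x ^+ p.-1 < (p%:R)^-1.

End PadicExp.

Section CayleyTree.
Variable k : nat.

(* The Cayley tree in which every vertex has k + 1 neighbours, as the Cayley
   graph of the free product of k + 1 copies of Z/2: a vertex is a word without
   two equal consecutive letters, the root is the empty word, and the direct
   successors of x are the vertices i :: x; the distance of x to the root is
   the length of x, see size_vertex_dist *)
Definition reduced (s : seq 'I_k.+1) : bool := sorted (fun i j => i != j) s.

Record vertex := Vertex {
  vertex_word :> seq 'I_k.+1; vertex_reduced : reduced vertex_word }.
HB.instance Definition _ := [isSub for vertex_word].
HB.instance Definition _ := [Countable of vertex by <:].

Definition root : vertex := @Vertex [::] isT.

Definition successor (x y : vertex) : bool :=
  [exists i, vertex_word y == i :: vertex_word x].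

Definition adjacent : rel vertex :=
  [rel x y | successor x y || successor y x].

Lemma successorP x y :
  reflect (exists i, vertex_word y = i :: vertex_word x) (successor x y).
Proof. exact: 'exists_eqP. Qed.

Lemma successor_size x y : successor x y -> size y = (size x).+1.
Proof. by case/successorP => i ->. Qed.

Lemma adjacent_sym : symmetric adjacent.
Proof. by move=> x y; rewrite /adjacent /= orbC. Qed.

Lemma adjacent_irrefl : irreflexive adjacent.
Proof.
move=> x; apply/negP; rewrite /adjacent /= orbb => xx.
by have /n_Sn := successor_size xx.
Qed.

Lemma predecessor_unique x y z : successor x z -> successor y z -> x = y.
Proof.
by case/successorP => i ez /successorP[j]; rewrite ez => -[_ ?]; exact: val_inj.
Qed.

Lemma card_neighbours (x : vertex) : exists s : seq vertex,
  [/\ uniq s, size s = k.+1 & forall y, (y \in s) = adjacent x y].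
Proof.
pose succs (A : seq 'I_k.+1) := [seq j :: vertex_word x | j <- A].
have usuccs A : uniq A -> uniq (succs A) by move=> ?; rewrite map_inj_uniq // => ? ? [].
case: x @succs usuccs => [[|i t] rt] succs usuccs.
  exists (pmap insub (succs (enum 'I_k.+1))).
  have sz : size (pmap insub (succs (enum 'I_k.+1)) : seq vertex) = k.+1.
    transitivity (size (succs (enum 'I_k.+1))).
      2: by rewrite size_map size_enum_ord.
    by apply/eqP; rewrite size_pmap_sub -all_count; apply/allP => s /mapP[j _ ->].
  split=> //; first by rewrite pmap_sub_uniq // usuccs // enum_uniq.
  move=> y; rewrite mem_pmap_sub; apply/mapP/idP => [[j _ e]|].
    by apply/orP; left; apply/successorP; exists j.
  by case/orP => /successorP[j]; [exists j; rewrite ?mem_enum|].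
exists (pmap insub (t :: succs (enum (predC1 i)))).
have rt' : reduced t by apply: path_sorted rt.
have sz : size (pmap insub (t :: succs (enum (predC1 i))) : seq vertex) = k.+1.
  transitivity (size (t :: succs (enum (predC1 i)))); last first.
    by rewrite /= size_map -cardE cardC1 card_ord.
  apply/eqP; rewrite size_pmap_sub -all_count /= rt' /=; apply/allP => s /mapP[j].
  rewrite mem_enum inE => ji -> /=; rewrite /reduced /= ji.
  exact: rt.
split=> //.
  rewrite pmap_sub_uniq //= usuccs ?enum_uniq // andbT.
  apply/mapP => -[j _ /(congr1 size)/= e].
  by have := leqnSn (size t); rewrite -ltnS -e ltnn.
move=> y; rewrite mem_pmap_sub inE; apply/orP/orP => -[].
- by move=> /eqP ye; right; apply/successorP; exists i; rewrite /= ye.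
- by move=> /mapP[j _ e]; left; apply/successorP; exists j.
- move=> /successorP[j e]; right; apply/mapP; exists j => //.
  rewrite mem_enum inE; have := vertex_reduced y; rewrite e /reduced /=.
  by case/andP.
- by move=> /successorP[j /= [_ ->]]; left.
Qed.

Lemma size_vertex_dist (x : vertex) :
  (exists s, [/\ path adjacent root s, last root s = x & size s = size x]) /\
  (forall s, path adjacent root s -> last root s = x -> (size x <= size s)%N).
Proof.
split; last first.
  move=> s; elim/last_ind: s x => [|s z IH] x; first by move=> _ <-.
  rewrite rcons_path last_rcons size_rcons => /andP[ps adj] <-{x}.
  have := IH _ ps erefl.
  by case/orP: adj => /successor_size => [->//|e le]; rewrite (leq_trans _ (leqW le)) // e leqnSn.
case: x; elim=> [|i t IH] rt; first by exists [::]; split=> //; exact: val_inj.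
have [s [ps ls ss]] := IH (path_sorted rt).
exists (rcons s (Vertex rt)); rewrite rcons_path last_rcons size_rcons ps ls ss.
split=> //=; apply/orP; left; apply/successorP; by exists i.
Qed.

(* the ball V_n; its boundary W_n consists of the words of length exactly n *)
Definition ball_vertices (n : nat) : Type :=
  {x : {bseq n of 'I_k.+1} | reduced x}.

Definition ball_vertex n (x : ball_vertices n) : vertex := Vertex (valP x).
Coercion ball_vertex : ball_vertices >-> vertex.

Definition ball_widen n (x : ball_vertices n) : ball_vertices n.+1 :=
  exist _ (widen_bseq (leqnSn n) (val x)) (valP x).

End CayleyTree.

Section Potts.
Variables (p : nat) (p_pr : prime p) (k q : nat).
Local Notation Qp := (padic p_pr).
Local Notation spin := 'I_q.
Local Notation config n := {ffun ball_vertices k n -> spin}.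

Definition restrict n (sigma : vertex k -> spin) : config n :=
  [ffun x : ball_vertices k n => sigma x].

Definition restrictS n (tau : config n.+1) : config n :=
  [ffun x => tau (ball_widen x)].

(* each edge of V_n is counted once, as a pair (x, direct successor of x) *)
Definition hamiltonian (J : Qp) n (tau : config n) : Qp :=
  J * \sum_(x : ball_vertices k n)
        \sum_(y : ball_vertices k n | successor x y) (tau x == tau y)%:R.

Section FiniteVolume.
Variables (J : Qp) (h : vertex k -> spin -> Qp).

Definition gibbs_weight n (tau : config n) : Qp :=
  padic_exp (hamiltonian J tau +
    \sum_(x : ball_vertices k n | size x == n) h x (tau x)).

Definition partition_function n : Qp := \sum_(tau : config n) gibbs_weight tau.

Definition gibbs_finite n (tau : config n) : Qp :=
  gibbs_weight tau / partition_function n.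

(* The sum runs over the configurations sigma \/ omega on V_{n+1}, i.e. the
   extensions of sigma. The formula for gibbs_finite is used on balls of radius
   n >= 1, whose boundary vertices all have k direct successors. The root has
   k + 1 of them: the one-site marginal at the root is not required to be of
   the form gibbs_finite, but is the one induced by the larger balls. *)
Definition compatible : Prop := forall n, (1 <= n)%N -> forall sigma : config n,
  \sum_(tau : config n.+1 | restrictS tau == sigma) gibbs_finite tau =
  gibbs_finite sigma.

End FiniteVolume.

Definition cylinders : set (set (vertex k -> spin)) :=
  [set A | exists n (B : {set config n}), A = [set sigma | restrict n sigma \in B]].

Definition padic_probability (mu : cylinders -> Qp) : Prop :=
  (forall A B C : cylinders, val A `&` val B = set0 ->
     val C = val A `|` val B -> mu C = mu A + mu B) /\
  (forall A : cylinders, val A = setT -> mu A = 1).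

Definition gibbs_measure_of (J : Qp) (h : vertex k -> spin -> Qp)
    (mu : cylinders -> Qp) : Prop :=
  [/\ forall x i, in_exp_domain (h x i),
      forall n, (1 <= n)%N -> partition_function J h n != 0,
      compatible J h,
      padic_probability mu &
      forall n, (1 <= n)%N -> forall (tau : config n) (A : cylinders),
        val A = [set sigma | restrict n sigma = tau] ->
        mu A = gibbs_finite J h tau].

(* the spins 1, .., q are 0, .., q - 1 here, so l is the reference spin q *)
Definition translation_invariant (h : vertex k -> spin -> Qp) : Prop :=
  forall l : spin, l = q.-1 :> nat -> forall x y i, h x i - h x l = h y i - h y l.

Definition TIpGM (J : Qp) : set (cylinders -> Qp) :=
  [set mu | exists2 h, translation_invariant h & gibbs_measure_of J h mu].

End Potts.

(* Main.v *)
(* With theta = exp J, s = theta - 1 and a set M of m spins, put z_i = x^3 for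
   i in M and z_i = 1 otherwise.  Such z is a translation-invariant boundary law
   exactly when (x - 1) c(x) = 0, where c(x) = m x^3 - s x^2 - s x + (q - m).
   When p does not divide m, a contraction argument gives a root x of c congruent
   to 1 modulo p; it differs from 1 because theta != 1 + q/2, and z then has a
   logarithm.  Roots of c near the other cube roots of unity exist only for
   p = 1 mod 3, so they are not used.  Instead the factor 3 comes from varying the
   size of M: p^3 divides q, so q >= 125, and among the eight sizes just below q/2
   at most two are divisible by p.  A further size may be lost because the
   partition function on the ball of radius 1 is a nonzero multiple of
   m x^4 + (q - m), which can vanish, but for at most one size m < q/2.  The five
   or more remaining sizes give at least 3 'C(q, m) measures, and M = empty one
   more. *)
Require Import Defs.
From HB Require Import structures.
From mathcomp Require Import all_boot all_order all_algebra.
From mathcomp Require Import all_classical all_reals all_analysis.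
From mathcomp Require Import ring zify.
Set Implicit Arguments.
Unset Strict Implicit.
Unset Printing Implicit Defensive.

(** * Binomial coefficients near the middle *)

Lemma bin_leS n m : m.*2 < n -> 'C(n, m) <= 'C(n, m.+1).
Proof.
move=> h; rewrite -(leq_pmul2l (ltn0Sn m)) mul_bin_left leq_mul2r; apply/orP; right; lia.
Qed.

Lemma bin_le_half n i j : i <= j -> j.*2 <= n -> 'C(n, i) <= 'C(n, j).
Proof.
elim: j => [|j IH]; first by rewrite leqn0 => /eqP ->.
rewrite leq_eqVlt => /orP[/eqP -> //|]; rewrite ltnS => ij h.
by apply: leq_trans (IH ij _) (bin_leS _); lia.
Qed.

(** When [n] is selected, the left side gains [B] at the number of indices selected before, which is
    at most [n], and the right side gains [B n]. *)
Lemma sum_selected_ge (B : nat -> nat) (g : nat -> bool) n :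
  (forall i j, i <= j < n -> B i <= B j) ->
  \sum_(i < \sum_(i < n) g i) B i <= \sum_(i < n) (if g i then B i else 0).
Proof.
elim: n => [|n IH] hB; first by rewrite !big_ord0.
rewrite !(big_ord_recr n) /=; have {}IH : \sum_(i < \sum_(i < n) g i) B i <= \sum_(i < n) (if g i then B i else 0).
  by apply: IH => i j /andP[ij /ltnW jn]; apply: hB; rewrite ij.
case: (g n); last by rewrite !addn0.
rewrite addn1 big_ord_recr /= leq_add //; apply: hB; rewrite ltnSn andbT.
by rewrite -[n in _ <= n]card_ord -sum1_card leq_sum // => i _; case: (g i).
Qed.

Lemma ratio_bound (a b u v x y : nat) : 0 < a -> a * x = b * y -> u * a <= v * b -> u * y <= v * x.
Proof.
move=> a0 e h; rewrite -(leq_pmul2l a0) [a * (v * x)]mulnCA e !mulnA leq_mul2r.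
by rewrite [a * u]mulnC h orbT.
Qed.

(* Both parities of n reduce to the rational lower bound (62 - j) / (64 + j) on
   the ratio of consecutive binomials, attained at n = 125; for even n this needs
   n >= 250, which holds for even multiples of 5^3. *)
Lemma bin_below_middle n c j : 62 <= c -> j < 8 -> j < c ->
  (n = c.*2.+1 \/ n = c.*2.+2 /\ 124 <= c) ->
  (62 - j) * 'C(n, c - j) <= (64 + j) * 'C(n, c - j.+1).
Proof.
move=> c62 j8 jc hn; have := mul_bin_left n (c - j.+1).
rewrite -subSn // subSS => /esym e.
apply: (ratio_bound _ e); first by case: hn; lia.
by case: hn => [->|[-> c124]]; do 8 (case: j jc e j8 => [|j] jc e j8; first by lia); lia.
Qed.

(** Chaining the ratio bounds, the five terms are at least about 0.410, 0.513, 0.621, 0.728 and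
    0.826 times ['C(n, c)], and these factors sum to about 3.098. *)
Lemma central_binomials n c : 62 <= c -> (n = c.*2.+1 \/ n = c.*2.+2 /\ 124 <= c) ->
  3 * 'C(n, c) <= \sum_(i < 5) 'C(n, c - 7 + i).
Proof.
move=> c62 hn; have h j := @bin_below_middle n c j c62.
rewrite !big_ord_recr big_ord0 /=.
have -> : c - 7 + 0 = c - 7 by lia.
have -> : c - 7 + 1 = c - 6 by lia.
have -> : c - 7 + 2 = c - 5 by lia.
have -> : c - 7 + 3 = c - 4 by lia.
have -> : c - 7 + 4 = c - 3 by lia.
have := h 0 isT (leq_trans _ c62) hn; have := h 1 isT (leq_trans _ c62) hn.
have := h 2 isT (leq_trans _ c62) hn; have := h 3 isT (leq_trans _ c62) hn.
have := h 4 isT (leq_trans _ c62) hn; have := h 5 isT (leq_trans _ c62) hn.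
have := h 6 isT (leq_trans _ c62) hn; rewrite !subn0.
move: ('C(n, c)) ('C(n, c - 1)) ('C(n, c - 2)) ('C(n, c - 3)) ('C(n, c - 4)) ('C(n, c - 5)) ('C(n, c - 6)) ('C(n, c - 7)).
move=> b0 b1 b2 b3 b4 b5 b6 b7 /(_ isT) h6 /(_ isT) h5 /(_ isT) h4 /(_ isT) h3 /(_ isT) h2 /(_ isT) h1 /(_ isT) h0.
(* Conversion turns the coefficients into numerals, which makes the goal linear. *)
have {}h0 : 62 * b0 <= 64 * b1 := h0; have {}h1 : 61 * b1 <= 65 * b2 := h1.
have {}h2 : 60 * b2 <= 66 * b3 := h2; have {}h3 : 59 * b3 <= 67 * b4 := h3.
have {}h4 : 58 * b4 <= 68 * b5 := h4; have {}h5 : 57 * b5 <= 69 * b6 := h5.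
have {}h6 : 56 * b6 <= 70 * b7 := h6.
clear -h0 h1 h2 h3 h4 h5 h6; lia.
Qed.

(** Distinct multiples of [p] differ by at least 5, so the offsets 0 to 4 contain at most one and
    the offsets 5 to 7 at most one. *)
Lemma few_multiples p d : 4 < p -> \sum_(i < 8) (p %| d + i) <= 2.
Proof.
move=> p5.
have pw i j : i < j -> j < i + 5 -> (p %| d + i) + (p %| d + j) <= 1.
  move=> ij ji; case: (boolP (p %| d + i)) => //= h1; case: (boolP (p %| d + j)) => //= h2.
  have := dvdn_sub h2 h1; rewrite subnDl gtnNdvd //; lia.
have := pw 0 1 isT isT; have := pw 0 2 isT isT; have := pw 0 3 isT isT; have := pw 0 4 isT isT.
have := pw 1 2 isT isT; have := pw 1 3 isT isT; have := pw 1 4 isT isT.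
have := pw 2 3 isT isT; have := pw 2 4 isT isT; have := pw 3 4 isT isT.
have := pw 5 6 isT isT; have := pw 5 7 isT isT; have := pw 6 7 isT isT.
rewrite !big_ord_recr big_ord0 /=.
move: (p %| d + 0) (p %| d + 1) (p %| d + 2) (p %| d + 3) (p %| d + 4) (p %| d + 5) (p %| d + 6) (p %| d + 7).
by do 8 case.
Qed.

(** Of eight sizes at most two are multiples of [p] and at most one is bad, which leaves 8 - 2 -
    1. *)
Lemma many_good_levels p d (bad : nat -> bool) : 4 < p ->
  (forall i j, bad i -> bad j -> i = j) ->
  5 <= \sum_(i < 8) ~~ ((p %| d + i) || bad (d + i)).
Proof.
move=> p5 bad1; have := few_multiples d p5.
have b1 : \sum_(i < 8) bad (d + i) <= 1.
  have [/existsP[i bi]|/existsPn nb] := boolP [exists i : 'I_8, bad (d + i)]; last first.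
    by rewrite big1 // => i _; rewrite (negPf (nb i)).
  rewrite (bigD1 i) //= bi big1 // => j ji; case: (boolP (bad _)) => // bj.
  by case/eqP: ji; apply/val_inj/(@addnI d); exact: bad1.
have : 8 <= \sum_(i < 8) ((p %| d + i) + bad (d + i) + ~~ ((p %| d + i) || bad (d + i))).
  apply: (@leq_trans (\sum_(i < 8) 1)); first by rewrite sum1_card card_ord.
  apply: leq_sum => i _.
  by case: (_ %| _); case: (bad _).
rewrite !big_split /=; move: b1.
by move: (\sum_(i < 8) bad _) (\sum_(i < 8) (p %| _)) (\sum_(i < 8) ~~ _) => u v w; lia.
Qed.

(* At least five of the levels c - 7, .., c survive; the worst case is that they
   are the five lowest. *)
Lemma binomial_levels_ge p n c m (bad : nat -> bool) : 4 < p ->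
  (forall i j, bad i -> bad j -> i = j) ->
  62 <= c -> (n = c.*2.+1 \/ n = c.*2.+2 /\ 124 <= c) -> m <= c ->
  3 * 'C(n, m) <= \sum_(k < n.+1 | [&& 0 < k, k.*2 < n, ~~ (p %| k) & ~~ bad k]) 'C(n, k).
Proof.
move=> p5 bad1 c62 hn mc; have c2 : c.*2 < n by case: hn; lia.
apply: leq_trans (leq_trans (_ : _ <= 3 * 'C(n, c)) (central_binomials c62 hn)) _.
  by rewrite leq_mul2l /= bin_le_half // ltnW.
set d := c - 7; pose g i := ~~ ((p %| d + i) || bad (d + i)).
apply: leq_trans (_ : \sum_(i < \sum_(i < 8) g i) 'C(n, d + i) <= _).
  have := many_good_levels d p5 bad1; rewrite -/(g _); move: (\sum_(i < 8) _) => s s5.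
  rewrite -!(big_mkord predT (fun i => 'C(n, d + i))).
  by rewrite (@big_cat_nat _ _ _ 5 0 s) //= leq_addr.
have dc : d + 7 = c by rewrite /d; lia.
have hB i j : i <= j < 8 -> 'C(n, d + i) <= 'C(n, d + j).
  by move=> /andP[ij j8]; apply: bin_le_half; lia.
apply: leq_trans (sum_selected_ge g hB) _.
rewrite -big_mkcond /= -(big_mkord (fun i => g i) (fun i => 'C(n, d + i))).
rewrite -[\sum_(k < n.+1 | _) _](big_mkord (fun k => [&& 0 < k, k.*2 < n, ~~ (p %| k) & ~~ bad k]) (fun k => 'C(n, k))).
have d1 : d <= n.+1 by lia.
have d8 : 8 + d <= n.+1 by lia.
(* Only the window from [d] to [d + 7 = c] is kept; there [0 < k] and [k.*2 < n] hold
   automatically. *)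
rewrite (@big_cat_nat _ _ _ d 0 n.+1) //= (@big_cat_nat _ _ _ (8 + d) d n.+1) ?leq_addl //=.
rewrite addnCA; apply: leq_trans (leq_addr _ _).
rewrite -{2}[d]add0n big_addn addnK big_nat_cond [X in _ <= X]big_nat_cond.
rewrite [X in _ <= X](eq_bigl (fun i => (0 <= i < 8) && g i)); last first.
  move=> i; rewrite /g negb_or [d + i]addnC /=; case i8 : (i < 8) => //=.
  have -> : 0 < i + d by lia.
  by have -> : (i + d).*2 < n by lia.
by apply/eq_leq/eq_bigr => i _; rewrite addnC.
Qed.

Import Order.TTheory GRing.Theory Num.Theory.
Local Open Scope classical_set_scope.
Local Open Scope card_scope.
Local Open Scope ring_scope.

(** * Analysis in Q_p *)

Section PadicAnalysis.
Variables (p : nat) (p_pr : prime p).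
Local Notation Qp := (padic p_pr).
Local Notation nm := (@padic_norm p p_pr).
Local Notation r := ((p%:R : rat)^-1).

Let p_gt0 : 0 < (p%:R : rat). Proof. by rewrite ltr0n prime_gt0. Qed.
Let p_gt1 : 1 < (p%:R : rat). Proof. by rewrite ltr1n prime_gt1. Qed.
Let r_gt0 : 0 < r. Proof. by rewrite invr_gt0. Qed.
Let r_ge0 : 0 <= r. Proof. exact: ltW. Qed.
Let r_lt1 : r < 1. Proof. by rewrite invf_lt1. Qed.
Let r_le1 : r <= 1. Proof. exact: ltW. Qed.

Lemma padic_normB (x y : Qp) : nm (x - y) <= Num.max (nm x) (nm y).
Proof. by rewrite -(padic_normN y) padic_normD. Qed.

Lemma padic_distC_norm (x y : Qp) : nm (x - y) = nm (y - x).
Proof. by rewrite -padic_normN opprB. Qed.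

Lemma padic_normD_le (x y : Qp) c : nm x <= c -> nm y <= c -> nm (x + y) <= c.
Proof. by move=> hx hy; rewrite (le_trans (padic_normD x y)) // ge_max hx hy. Qed.

Lemma padic_normD_lt (x y : Qp) c : nm x < c -> nm y < c -> nm (x + y) < c.
Proof. by move=> hx hy; rewrite (le_lt_trans (padic_normD x y)) // gt_max hx hy. Qed.

Lemma padic_normB_lt (x y : Qp) c : nm x < c -> nm y < c -> nm (x - y) < c.
Proof. by move=> hx hy; rewrite (le_lt_trans (padic_normB x y)) // gt_max hx hy. Qed.

Lemma padic_normX (x : Qp) n : nm (x ^+ n) = nm x ^+ n.
Proof. by elim: n => [|n IH]; rewrite ?expr0 ?padic_norm1 // !exprS padic_normM IH. Qed.

Lemma padic_normV (x : Qp) : nm x^-1 = (nm x)^-1.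
Proof.
have [->|x0] := eqVneq x 0; first by rewrite invr0 padic_norm0 invr0.
have nx : nm x != 0 by rewrite padic_norm_eq0.
by apply: (mulIf nx); rewrite -padic_normM !mulVf // padic_norm1.
Qed.

Lemma padic_norm_sum_le I (s : seq I) (P : pred I) (F : I -> Qp) c : 0 <= c ->
  (forall i, P i -> nm (F i) <= c) -> nm (\sum_(i <- s | P i) F i) <= c.
Proof.
move=> c0 h; elim/big_ind: _ => //; first by rewrite padic_norm0.
by move=> x y; exact: padic_normD_le.
Qed.

Lemma padic_norm_eq_lt (x y : Qp) : nm (x - y) < nm y -> nm x = nm y.
Proof.
move=> h; apply/eqP; rewrite eq_le; apply/andP; split.
  by rewrite -{1}(subrK y x) padic_normD_le // ltW.
rewrite leNgt; apply/negP => lt.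
have := padic_normB_lt lt h; rewrite opprB addrC subrK ltxx //.
Qed.

Lemma padic_norm_valued (x : Qp) : x != 0 -> exists z : int, nm x = p%:R ^ z.
Proof.
have [u <-] := padic_pi_surj x => u0.
have [n0 /(_ _ (leqnn n0)) e] := padic_norm_pi u0; rewrite -e /rat_padic_norm.
case: ifPn => [/eqP un0|_]; last by eexists.
by move: u0; rewrite -padic_norm_eq0 -e un0 rat_padic_norm0 eqxx.
Qed.

Lemma padic_norm_lt1 (x : Qp) : nm x < 1 -> nm x <= r.
Proof.
have [->|x0] := eqVneq x 0; first by rewrite padic_norm0.
have [z ->] := padic_norm_valued x0.
rewrite -[1](expr0z (p%:R : rat)) ltr_eXz2l // => z0.
by rewrite -[r](exprN1 (p%:R : rat)) ler_eXz2l //; lia.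
Qed.

(** No norm lies strictly between 1/p and 1, and the radius of convergence falls into that gap
    because p - 1 > 1. *)
Lemma in_exp_domainE (p_gt3 : (3 < p)%N) (x : Qp) : in_exp_domain x <-> nm x < 1.
Proof.
rewrite /in_exp_domain; split.
  move=> h; rewrite ltNge; apply/negP => x1.
  have := lt_trans h r_lt1; rewrite ltNge; move/negP; apply.
  exact: exprn_ege1.
move/padic_norm_lt1 => h.
have : nm x ^+ p.-1 <= r ^+ p.-1 by rewrite lerXn2r ?nnegrE ?padic_norm_ge0.
move/le_lt_trans; apply; rewrite -{2}[r]expr1 ltr_iXn2l //.
by rewrite -subn1 ltn_subRL; lia.
Qed.

Lemma padic_norm_nat_le1 n : nm (n%:R) <= 1.
Proof.
elim: n => [|n IH]; first by rewrite padic_norm0.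
by rewrite -addn1 natrD padic_normD_le ?padic_norm1.
Qed.

Lemma padic_norm_natE n : (0 < n)%N -> nm n%:R = r ^+ logn p n.
Proof.
move=> n0; rewrite padic_norm_nat //.
have -> : (n%:R : rat) = (n%:Z)%:~R / (1%:Z)%:~R by rewrite divr1.
rewrite rat_padic_norm_frac // ?eqz_nat -?lt0n //= logn1 sub0r.
by rewrite -exprnN exprVn.
Qed.

Lemma padic_natr_eq0 n : (n%:R == 0 :> Qp) = (n == 0)%N.
Proof.
case: n => [|n]; first by rewrite mulr0n !eqxx.
rewrite -padic_norm_eq0 (padic_norm_natE (ltn0Sn n)).
by rewrite gt_eqF // exprn_gt0.
Qed.

Lemma padic_norm_nat_unit n : ~~ (p %| n)%N -> nm n%:R = 1.
Proof.
case: n => [|n] h; first by rewrite dvdn0 in h.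
by rewrite padic_norm_natE // lognE (negPf h) !andbF.
Qed.

Lemma padic_norm_nat_lt1 n : (nm n%:R < 1) = (p %| n)%N.
Proof.
case: (boolP (p %| n)%N) => [|/padic_norm_nat_unit ->]; last by rewrite ltxx.
case: n => [|n] h; first by rewrite padic_norm0 ltr01.
rewrite padic_norm_natE // lognE p_pr h /= exprS.
by rewrite (le_lt_trans _ r_lt1) // ler_piMr // exprn_ile1.
Qed.

(** Keeps the estimates free of filters; [pcvg_cvg] transfers the result to the limit that defines
    [padic_exp]. *)
Definition pcvg (u : nat -> Qp) (l : Qp) :=
  forall e : rat, 0 < e -> exists n0, forall i, (n0 <= i)%N -> nm (u i - l) < e.

Lemma pcvg_unique u l l' : pcvg u l -> pcvg u l' -> l = l'.
Proof.
move=> h h'; apply/eqP; rewrite -subr_eq0 -padic_norm_eq0 eq_le padic_norm_ge0 andbT.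
rewrite leNgt; apply/negP => e0.
have [n hn] := h _ e0; have [n' hn'] := h' _ e0.
have := padic_normB_lt (hn' _ (leq_maxr n n')) (hn _ (leq_maxl n n')).
by rewrite opprB addrC subrKA ltxx.
Qed.

Lemma pcvg_le u l c : pcvg u l -> (exists n0, forall i, (n0 <= i)%N -> nm (u i) <= c) -> nm l <= c.
Proof.
move=> h [n hc]; rewrite leNgt; apply/negP => lc.
have c0 : 0 <= c by exact: le_trans (padic_norm_ge0 _) (hc _ (leqnn n)).
have [n' hn] := h _ (le_lt_trans c0 lc).
have := padic_norm_eq_lt (hn _ (leq_maxr n n')).
have := hc _ (leq_maxl n n'); move=> /le_lt_trans /(_ lc) /[swap] ->.
by rewrite ltxx.
Qed.

Lemma pcvgD u v l l' : pcvg u l -> pcvg v l' -> pcvg (fun i => u i + v i) (l + l').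
Proof.
move=> h h' e e0; have [n hn] := h _ e0; have [n' hn'] := h' _ e0.
exists (maxn n n') => i; rewrite geq_max => /andP[/hn hi /hn' hi'].
by rewrite opprD addrACA padic_normD_lt.
Qed.

Lemma pcvg_cst l : pcvg (fun=> l) l.
Proof. by move=> e e0; exists 0%N => i _; rewrite subrr padic_norm0. Qed.

Lemma pcvgN u l : pcvg u l -> pcvg (fun i => - u i) (- l).
Proof. by move=> h e /h [n hn]; exists n => i /hn; rewrite -opprD padic_normN. Qed.

Lemma pcvgM u v l l' : (forall i, nm (u i) <= 1) -> nm l' <= 1 ->
  pcvg u l -> pcvg v l' -> pcvg (fun i => u i * v i) (l * l').
Proof.
move=> u1 l1 h h' e e0; have [n hn] := h _ e0; have [n' hn'] := h' _ e0.
exists (maxn n n') => i; rewrite geq_max => /andP[/hn hi /hn' hi'].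
have -> : u i * v i - l * l' = u i * (v i - l') + (u i - l) * l'.
  by rewrite mulrBr mulrBl subrKA.
apply: padic_normD_lt; rewrite padic_normM.
  by rewrite (le_lt_trans _ hi') // ler_piMl ?padic_norm_ge0.
by rewrite (le_lt_trans _ hi) // ler_piMr ?padic_norm_ge0.
Qed.

Lemma r_exp_small (e : rat) : 0 < e -> exists n0, forall i, (n0 <= i)%N -> r ^+ i < e.
Proof.
move=> e0; exists (Num.bound e^-1) => i hi.
rewrite exprVn -[e]invrK ltf_pV2 ?posrE ?exprn_gt0 ?invr_gt0 //.
have := archi_boundP (ltW (_ : 0 < e^-1)); rewrite invr_gt0 => /(_ e0) /lt_le_trans; apply.
rewrite -natrX ler_nat (leq_trans hi) // ltnW // ltn_expl // prime_gt1 //.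
Qed.


Local Notation N := (rat_padic_norm p).
Local Notation P := (\pi_(padic p_pr))%qT.

Lemma padic_norm_pi_lt (u : padic_seq p_pr) e : 0 < e ->
  (exists n0, forall i, (n0 <= i)%N -> N (u i) < e) -> nm (P u) < e.
Proof.
move=> e0 [n hn]; have [->|/padic_norm_pi[n' hn']] := eqVneq (P u) 0.
  by rewrite padic_norm0.
by rewrite -(hn' _ (leq_maxr n n')) hn // leq_maxl.
Qed.

Fact const_seq_cauchy (a : rat) : (fun=> a) \in padic_cauchyb p_pr.
Proof. by apply/asboolP => e e0; exists 0%N => i j _ _; rewrite subrr rat_padic_norm0. Qed.

Definition const_seq (a : rat) : padic_seq p_pr := PadicSeq (const_seq_cauchy a).

Lemma pi_padicB (u v : padic_seq p_pr) : P (u - v) = P u - P v.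
Proof. by apply/eqP; rewrite eq_sym subr_eq -(@pi_addr _ _ _ _ _ (padic p_pr)) subrK. Qed.

Lemma padic_dense (x : Qp) e : 0 < e -> exists a, nm (x - P (const_seq a)) < e.
Proof.
move=> e0; have [u <-] := padic_pi_surj x; have [n hn] := padic_seq_cauchy u e0.
exists (u n); rewrite -pi_padicB; apply: padic_norm_pi_lt => //; exists n => i hi.
exact: hn.
Qed.

Lemma padic_norm_const a : nm (P (const_seq a)) = N a.
Proof.
have [e|/padic_norm_pi[n /(_ n (leqnn n)) <- //]] := eqVneq (P (const_seq a)) 0.
rewrite e padic_norm0; apply/eqP; rewrite eq_sym; apply/negPn/negP => na.
have a0 : 0 < N a by rewrite lt_def na rat_padic_norm_ge0.
move/eqP: e; rewrite padic_pi_eq0 => /asboolP /(_ _ a0) [n /(_ n (leqnn n))].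
by rewrite ltxx.
Qed.

(** By the ultrametric inequality, small consecutive differences already make a Cauchy sequence.
    Rationals within [r ^+ i] of [u i] are then Cauchy too, and their class is the limit. *)
Lemma padic_complete (u : nat -> Qp) :
  (forall e : rat, 0 < e -> exists n0, forall i, (n0 <= i)%N -> nm (u i.+1 - u i) < e) ->
  exists l, pcvg u l.
Proof.
move=> hu.
have cu e : 0 < e -> exists n0, forall i, (n0 <= i)%N -> nm (u i - u n0) < e.
  move=> e0; have [n hn] := hu _ e0; exists n; elim=> [|i IH].
    by rewrite leqn0 => /eqP ->; rewrite subrr padic_norm0.
  rewrite leq_eqVlt => /orP[/eqP <-|]; first by rewrite subrr padic_norm0.
  rewrite ltnS => ni; rewrite -(subrKA (u i)); apply: padic_normD_lt; [exact: hn|exact: IH].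
have [a ha] := choice (fun i => padic_dense (u i) (exprn_gt0 i r_gt0)).
have ca e : 0 < e -> exists n0, forall i j, (n0 <= i)%N -> (n0 <= j)%N -> N (a i - a j) < e.
  move=> e0; have [n hn] := cu _ e0; have [n' hn'] := r_exp_small e0.
  exists (maxn n n') => i j; rewrite !geq_max => /andP[i1 i2] /andP[j1 j2].
  rewrite -padic_norm_const.
  have -> : const_seq (a i - a j) = const_seq (a i) - const_seq (a j) by exact: val_inj.
  rewrite pi_padicB -(subrKA (u i)).
  apply: padic_normD_lt.
    by rewrite padic_distC_norm (lt_trans (ha i)) // hn'.
  rewrite -(subrKA (u j)); apply: padic_normD_lt; last by rewrite (lt_trans (ha j)) // hn'.
  rewrite -(subrKA (u n)); apply: padic_normD_lt; first exact: hn.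
  by rewrite padic_distC_norm; exact: hn.
have sa : a \in padic_cauchyb p_pr by exact/asboolP.
exists (P (PadicSeq sa)) => e e0.
have [n hn] := ca _ e0; have [n' hn'] := r_exp_small e0.
exists (maxn n n') => i; rewrite geq_max => /andP[i1 i2].
rewrite -(subrKA (P (const_seq (a i)))); apply: padic_normD_lt.
  by rewrite (lt_trans (ha i)) // hn'.
rewrite -pi_padicB; apply: padic_norm_pi_lt => //; exists n => j hj.
exact: hn.
Qed.

(** Serves twice: for the logarithm and for the root of the cubic. *)
Lemma padic_contraction (T : Qp -> Qp) :
  (forall a, nm a < 1 -> nm (T a) < 1) ->
  (forall a b, nm a < 1 -> nm b < 1 -> nm (T a - T b) <= r * nm (a - b)) ->
  exists2 a, nm a < 1 & T a = a.
Proof.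
move=> T1 Tc; pose u n := iter n T 0.
have u1 n : nm (u n) < 1 by elim: n => [|n IH]; rewrite ?padic_norm0 //=; exact: T1.
have du n : nm (u n.+1 - u n) <= r ^+ n.
  elim: n => [|n IH]; first by rewrite expr0 ltW // padic_normB_lt.
  rewrite exprS; apply: le_trans (ler_wpM2l r_ge0 IH).
  by apply: Tc; [exact: (u1 n.+1)|exact: u1].
have [l hl] : exists l, pcvg u l.
  apply: padic_complete => e /r_exp_small [n hn]; exists n => i /hn.
  exact/le_lt_trans/du.
(* The open unit ball contains its limits, since norms below 1 are at most [r]. *)
have l1 : nm l < 1.
  apply: (le_lt_trans _ r_lt1); apply: pcvg_le hl _; exists 0%N => i _.
  exact: padic_norm_lt1.
exists l => //; apply: (@pcvg_unique (fun i => u i.+1)); last first.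
  by move=> e /hl [n hn]; exists n => i ni; apply: hn; apply: leq_trans (leqnSn i).
move=> e e0; have [n hn] := hl e e0; exists n => i /hn h.
apply: le_lt_trans h; apply: le_trans (Tc _ _ (u1 i) l1) _.
by rewrite ler_piMl // padic_norm_ge0.
Qed.

End PadicAnalysis.

(** * The p-adic exponential and logarithm *)

Lemma logn_fact_le p n : prime p -> (p.-1 * logn p n`! <= n)%N.
Proof.
move=> p_pr; rewrite logn_fact //.
(* Legendre's sum cut off at [K]. The extra term [n %/ p ^ K] carries the induction, being at least
   [p] times the next quotient. *)
suff h K : (p.-1 * (\sum_(1 <= k < K.+1) n %/ p ^ k) + n %/ p ^ K <= n)%N.
  exact: leq_trans (leq_addr _ _) (h n).
elim: K => [|K IH]; first by rewrite big_geq // muln0 expn0 divn1.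
rewrite big_nat_recr //= mulnDr -addnA -mulSnr prednK ?prime_gt0 //.
apply: leq_trans IH; rewrite leq_add2l expnSr divnMA mulnC.
exact: leq_divM.
Qed.

Lemma scaled_quotient_mul (F : fieldType) (u v x y z : F) : x != 0 -> y != 0 -> z != 0 ->
  v * u * x / (x * (z * y)) = u / z * (v / y).
Proof. by move=> x0 y0 z0; field; rewrite x0 y0 z0. Qed.

Section PadicExpTheory.
Variables (p : nat) (p_pr : prime p) (p_gt3 : (3 < p)%N).
Local Notation Qp := (padic p_pr).
Local Notation nm := (@padic_norm p p_pr).
Local Notation r := ((p%:R : rat)^-1).

Let p_gt0 : 0 < (p%:R : rat). Proof. by rewrite ltr0n prime_gt0. Qed.
Let p_gt1 : 1 < (p%:R : rat). Proof. by rewrite ltr1n prime_gt1. Qed.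
Let r_gt0 : 0 < r. Proof. by rewrite invr_gt0. Qed.
Let r_ge0 : 0 <= r. Proof. exact: ltW. Qed.
Let r_lt1 : r < 1. Proof. by rewrite invf_lt1. Qed.
Let r_le1 : r <= 1. Proof. exact: ltW. Qed.

Let p_ge5 : (4 <= p.-1)%N.
Proof.
case: (leqP 5 p) => h; first by lia.
have e : p = 4 by lia.
by move: (p_pr); rewrite e.
Qed.

Let logn_fact4 n : (4 * logn p n`! <= n)%N.
Proof. by apply: leq_trans (logn_fact_le n p_pr); rewrite leq_mul2r p_ge5 orbT. Qed.

Lemma norm_fact n : nm (n`!%:R)^-1 * r ^+ logn p n`! = 1.
Proof.
rewrite padic_normV -padic_norm_natE ?fact_gt0 // mulVf //.
by rewrite padic_norm_eq0 padic_natr_eq0 -lt0n fact_gt0.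
Qed.

(** As p >= 5, the valuation of n! is at most n/4, so that of the term is at least n - n/4. *)
Lemma exp_term_norm (x : Qp) n : nm x < 1 -> nm (x ^+ n / n`!%:R) <= r ^+ n./2.
Proof.
move=> /padic_norm_lt1 x1; rewrite padic_normM padic_normX.
have h : nm x ^+ n <= r ^+ n./2 * r ^+ logn p n`!.
  rewrite -exprD; apply: le_trans (_ : r ^+ n <= _).
    by rewrite lerXn2r ?nnegrE ?padic_norm_ge0.
  rewrite ler_wiXn2l //; have := logn_fact4 n; lia.
have := ler_wpM2r (padic_norm_ge0 (n`!%:R^-1 : Qp)) h.
by rewrite /= -mulrA (mulrC (r ^+ logn _ _)) norm_fact mulr1.
Qed.

(** The cofactor of [a - b] in [a ^+ n - b ^+ n] has valuation at least n - 1, which exceeds the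
    valuation of n! once n >= 2. *)
Lemma exp_term_lipschitz (a b : Qp) n : nm a < 1 -> nm b < 1 -> (1 < n)%N ->
  nm (a ^+ n / n`!%:R - b ^+ n / n`!%:R) <= r * nm (a - b).
Proof.
move=> /padic_norm_lt1 a1 /padic_norm_lt1 b1 n1.
rewrite -mulrBl subrXX !padic_normM mulrC mulrCA mulrC ler_wpM2r ?padic_norm_ge0 //.
have h : nm (\sum_(i < n) a ^+ (n.-1 - i) * b ^+ i) <= r * r ^+ logn p n`!.
  apply: padic_norm_sum_le => [|i _]; first by rewrite mulr_ge0 ?exprn_ge0.
  rewrite padic_normM !padic_normX; apply: le_trans (_ : r ^+ (n.-1 - i) * r ^+ i <= _).
    by apply: ler_pM; rewrite ?exprn_ge0 ?padic_norm_ge0 ?lerXn2r ?nnegrE ?padic_norm_ge0.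
  rewrite -exprD -exprS ler_wiXn2l //; have := logn_fact4 n; have := ltn_ord i; lia.
have := ler_wpM2l (padic_norm_ge0 (n`!%:R^-1 : Qp)) h.
by rewrite /= mulrCA norm_fact mulr1.
Qed.

Definition exp_sum (x : Qp) n : Qp := \sum_(0 <= i < n) x ^+ i / i`!%:R.

Lemma exp_sum_cvg (x : Qp) : nm x < 1 -> exists l, pcvg (exp_sum x) l.
Proof.
move=> x1; apply: padic_complete => e /(r_exp_small p_pr) [n hn].
exists n.*2 => i hi; rewrite /exp_sum big_nat_recr //= addrAC subrr add0r.
by rewrite (le_lt_trans (exp_term_norm _ x1)) // hn //; lia.
Qed.

Lemma pcvg_cvg (u : nat -> Qp) l : pcvg u l -> u @ \oo --> l.
Proof.
move=> h; apply/cvg_ballP => e /h [n hn]; exists n => // i /= ni.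
by rewrite ballEmdist /= /mdist /= /padic_dist padic_distC_norm; exact: hn.
Qed.

Lemma exp_sumP (x : Qp) : nm x < 1 -> pcvg (exp_sum x) (padic_exp x).
Proof.
move=> /exp_sum_cvg [l hl]; suff -> : padic_exp x = l by [].
by apply: cvg_lim; [exact: metric_hausdorff|exact: pcvg_cvg hl].
Qed.

Lemma exp_sum_norm_le1 (x : Qp) n : nm x < 1 -> nm (exp_sum x n) <= 1.
Proof.
move=> x1; apply: padic_norm_sum_le => // i _; apply: le_trans (exp_term_norm _ x1) _.
by rewrite exprn_ile1.
Qed.

Lemma padic_exp_norm_le1 (x : Qp) : nm x < 1 -> nm (padic_exp x) <= 1.
Proof.
move=> x1; apply: pcvg_le (exp_sumP x1) _; exists 0%N => i _.
exact: exp_sum_norm_le1.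
Qed.

Lemma sum_antidiagonals (V : nmodType) (F : nat -> nat -> V) n :
  \sum_(k < n) \sum_(i < k.+1) F i (k - i)%N = \sum_(i < n) \sum_(j < n | (i + j < n)%N) F i j.
Proof.
under eq_bigr => k _ do rewrite (big_ord_widen n (fun i => F i (k - i)%N)) //.
rewrite (exchange_big_dep predT) //=; apply: eq_bigr => i _.
transitivity (\sum_(i <= k < n) F i (k - i)%N).
  by rewrite big_geq_mkord; apply: eq_bigl => k; rewrite ltnS.
rewrite -{1}[i : nat]add0n big_addn big_mkord.
rewrite (big_ord_widen n (fun j => F i (j + i - i)%N)) ?leq_subr //.
by apply: eq_big => [j|j _]; rewrite ?ltn_subRL // addnK.
Qed.

Lemma exp_poly_sum (a b : Qp) n :
  \sum_(k < n) (a + b) ^+ k / k`!%:R =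
  \sum_(i < n) \sum_(j < n | (i + j < n)%N) (a ^+ i / i`!%:R) * (b ^+ j / j`!%:R).
Proof.
rewrite -(sum_antidiagonals (fun i j => (a ^+ i / i`!%:R) * (b ^+ j / j`!%:R))).
apply: eq_bigr => k _; rewrite addrC exprDn big_distrl /=; apply: eq_bigr => i _.
have f0 m : m`!%:R != 0 :> Qp by rewrite padic_natr_eq0 -lt0n fact_gt0.
have ik : (i <= k)%N by rewrite -ltnS.
rewrite -(bin_fact ik) !natrM -mulr_natr; have := f0 i; have := f0 (k - i)%N.
have : 'C(k, i)%:R != 0 :> Qp by rewrite padic_natr_eq0 -lt0n bin_gt0.
exact: scaled_quotient_mul.
Qed.

(** The difference consists of the products with [n <= i + j]; rounding both halves of such a pair
    down loses at most 1 from [n./2]. *)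
Lemma exp_sumD_norm (a b : Qp) n : nm a < 1 -> nm b < 1 ->
  nm (exp_sum a n * exp_sum b n - exp_sum (a + b) n) <= r ^+ (n./2).-1.
Proof.
move=> a1 b1; rewrite /exp_sum !big_mkord.
pose F i j : Qp := (a ^+ i / i`!%:R) * (b ^+ j / j`!%:R).
have -> : \sum_(i < n) (a + b) ^+ i / i`!%:R = \sum_(i < n) \sum_(j < n | (i + j < n)%N) F i j.
  exact: exp_poly_sum.
rewrite big_distrl /= -sumrB; apply: padic_norm_sum_le => [|i _]; first exact: exprn_ge0.
rewrite big_distrr /= [X in _ - X]big_mkcond /= -sumrB.
apply: padic_norm_sum_le => [|j _]; first exact: exprn_ge0.
case: ltnP => h; first by rewrite subrr padic_norm0 exprn_ge0.
rewrite subr0 padic_normM; apply: le_trans (_ : r ^+ i./2 * r ^+ j./2 <= _).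
  by rewrite ler_pM ?padic_norm_ge0 ?exp_term_norm.
by rewrite -exprD ler_wiXn2l //; lia.
Qed.

Lemma padic_expD (a b : Qp) : nm a < 1 -> nm b < 1 ->
  padic_exp (a + b) = padic_exp a * padic_exp b.
Proof.
move=> a1 b1; apply: (@pcvg_unique _ _ (fun n => exp_sum a n * exp_sum b n)); last first.
  apply: pcvgM; [move=> i; exact: exp_sum_norm_le1|exact: padic_exp_norm_le1| |]; exact: exp_sumP.
move=> e e0; have [n hn] := exp_sumP (padic_normD_lt a1 b1) e0.
have [n' hn'] := r_exp_small p_pr e0.
exists (maxn n n'.*2.+2) => i; rewrite geq_max => /andP[/hn i1 i2].
rewrite -(subrKA (exp_sum (a + b) i)); apply: padic_normD_lt => //.
by rewrite (le_lt_trans (exp_sumD_norm _ a1 b1)) // hn' //; clear -i2; lia.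
Qed.

Lemma padic_exp0 : padic_exp (0 : Qp) = 1.
Proof.
have n0 : nm 0 < 1 by rewrite padic_norm0.
apply: (pcvg_unique (exp_sumP n0)) => e e0; exists 1%N => -[//|i] _.
rewrite /exp_sum big_nat_recl //= expr0 fact0 divr1 big1 ?addr0 ?subrr ?padic_norm0 // => j _.
by rewrite expr0n /= mul0r.
Qed.

Lemma padic_exp_neq0 (x : Qp) : nm x < 1 -> padic_exp x != 0.
Proof.
move=> x1; apply/eqP => e; have := @padic_expD x (- x) x1.
rewrite padic_normN subrr padic_exp0 e mul0r => /(_ x1) /eqP.
by rewrite oner_eq0.
Qed.

Lemma padic_exp_sum I (s : seq I) (P : pred I) (F : I -> Qp) :
  (forall i, nm (F i) < 1) ->
  padic_exp (\sum_(i <- s | P i) F i) = \prod_(i <- s | P i) padic_exp (F i).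
Proof.
move=> F1; pose K (x y : Qp) := nm x < 1 /\ padic_exp x = y.
suff [] : K (\sum_(i <- s | P i) F i) (\prod_(i <- s | P i) padic_exp (F i)) by [].
elim/big_rec2: _ => [|i y x _ [x1 <-]]; first by rewrite /K padic_norm0 padic_exp0.
by split; [exact: padic_normD_lt|rewrite padic_expD].
Qed.

Lemma padic_expMn (x : Qp) n : nm x < 1 -> padic_exp (x *+ n) = padic_exp x ^+ n.
Proof.
move=> x1; rewrite -[n in LHS]card_ord -[n in RHS]card_ord -sumr_const -prodr_const.
exact: padic_exp_sum.
Qed.

(** The terms 1 and x of the series cancel, and every later term contracts by [r]. This yields both
    the size of [padic_exp x - 1] and the logarithm. *)
Lemma padic_exp_lipschitz (a b : Qp) : nm a < 1 -> nm b < 1 ->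
  nm ((padic_exp a - a) - (padic_exp b - b)) <= r * nm (a - b).
Proof.
move=> a1 b1.
have h := pcvgD (pcvgD (exp_sumP a1) (pcvgN (pcvg_cst a)))
  (pcvgN (pcvgD (exp_sumP b1) (pcvgN (pcvg_cst b)))).
apply: pcvg_le h _; exists 2%N => -[//|[//|n]] _.
rewrite /exp_sum !big_nat_recl //= !(expr0, fact0, expr1, factS, fact0, muln1) !divr1.
set A := \sum_(_ <= _ < _) _; set B := \sum_(_ <= _ < _) _.
have -> : 1 + (a + A) - a - (1 + (b + B) - b) = A - B.
  by rewrite ![1 + (_ + _)]addrCA ![_ + (1 + _) - _]addrC !addKr opprD addrACA subrr add0r.
rewrite -sumrB; apply: padic_norm_sum_le => [|i _]; first by rewrite mulr_ge0 ?padic_norm_ge0.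
exact: (@exp_term_lipschitz a b i.+2).
Qed.

Lemma padic_exp_sub1_norm (x : Qp) : nm x < 1 -> nm (padic_exp x - 1) = nm x.
Proof.
move=> x1; have [->|x0] := eqVneq x 0; first by rewrite padic_exp0 subrr.
have z1 : nm (0 : Qp) < 1 by rewrite padic_norm0.
apply: padic_norm_eq_lt; have := padic_exp_lipschitz x1 z1.
rewrite padic_exp0 !subr0 addrAC => /le_lt_trans; apply.
by rewrite gtr_pMl // lt_def padic_norm_eq0 x0 padic_norm_ge0.
Qed.

(** The logarithm of [z] is a fixed point of h -> h - (exp h - z), written so that the contracting
    part exp h - h stands out. *)
Lemma padic_exp_surj (z : Qp) : nm (z - 1) < 1 -> exists2 h, nm h < 1 & padic_exp h = z.
Proof.
move=> z1; have [||h h1 hh] := @padic_contraction _ p_pr (fun h => (z - 1) - (padic_exp h - h - 1)).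
- move=> a a1; apply: padic_normB_lt => //; rewrite addrAC.
  by apply: padic_normB_lt => //; rewrite padic_exp_sub1_norm.
- move=> a b a1 b1; rewrite padic_distC_norm.
  have -> x u v : x - (v - 1) - (x - (u - 1)) = u - v :> Qp.
    by rewrite [- (x - _)]opprB addrC subrKA [- (v - _)]opprB subrKA.
  exact: padic_exp_lipschitz.
exists h => //; move/eqP: hh; rewrite -subr_eq0.
rewrite [- (_ - 1)]opprB addrA [z - 1 + 1]subrK opprB addrA [_ - _ - h]addrAC addrK.
by rewrite subr_eq0 => /eqP.
Qed.

End PadicExpTheory.

(** * The boundary law *)

Section CubicIdentities.
Variable F : fieldType.
Implicit Types (a b x y s m n q : F).

(* (x - 1) * cubic m s q x is the numerator of the fixed-point equation
   x = ((s + m) x^3 + q - m) / (m x^3 + q - m + s). *)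
Definition cubic m s q x := m * x ^+ 3 - s * x ^+ 2 - s * x + (q - m).

(** [cubic m s q (1 + y) = 0] solved for the term 3 m y that comes from m x^3. *)
Definition cubic_step m s q y :=
  (s * (1 + y) * (2%:R + y) - q) / (3%:R * m) - y ^+ 2 - y ^+ 3 / 3%:R.

Lemma cubic_step_fixed m s q y : m != 0 -> 3%:R != 0 :> F ->
  cubic_step m s q y = y -> cubic m s q (1 + y) = 0.
Proof.
move=> m0 h3 e; rewrite [LHS](_ : _ = 3%:R * m * (y - cubic_step m s q y)).
  by rewrite e subrr mulr0.
by rewrite /cubic /cubic_step; field; rewrite m0 h3.
Qed.

Lemma cubic_step_diff m s q a b : m != 0 -> 3%:R != 0 :> F ->
  cubic_step m s q a - cubic_step m s q b =
  (a - b) * (s * (3%:R + a + b) / (3%:R * m) - (a + b) - (a ^+ 2 + a * b + b ^+ 2) / 3%:R).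
Proof. by move=> m0 h3; rewrite /cubic_step; field; rewrite m0 h3. Qed.

Lemma cubic1 m s q : cubic m s q 1 = q - 2%:R * s.
Proof. by rewrite /cubic; ring. Qed.

(** The left side and the last bracket are the values of [transfer] on M and off M for z = x^3.
    Their quotient x has cube z, as a boundary law with three successors requires. *)
Lemma cubic_boundary_law m s q x : cubic m s q x = 0 ->
  s * x ^+ 3 + m * x ^+ 3 + (q - m) = x * (m * x ^+ 3 + (q - m) + s).
Proof.
move=> h; apply/eqP; rewrite -subr_eq0; apply/eqP.
transitivity ((1 - x) * cubic m s q x); last by rewrite h mulr0.
by rewrite /cubic; ring.
Qed.

(** The two equations give q = m (1 - x^4) and s (x + 1) = m x^2 (1 - x); multiplying the latter by
    (x + 1) (x^2 + 1) eliminates m. *)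
Lemma degenerate_quartic m s q x : x != 0 -> cubic m s q x = 0 ->
  m * x ^+ 4 + (q - m) = 0 -> s * (x + 1) ^+ 2 * (x ^+ 2 + 1) = q * x ^+ 2.
Proof.
move=> x0 hc hd; have eq : q = m - m * x ^+ 4 by apply/eqP; rewrite -subr_eq0 -hd; apply/eqP; ring.
have es : s * (x + 1) = m * x ^+ 2 * (1 - x).
  apply: (mulfI x0); apply/eqP; rewrite -subr_eq0; apply/eqP.
  by rewrite -[RHS]oppr0 -hc /cubic eq; ring.
rewrite expr2 mulrA es eq; ring.
Qed.

(* In terms of x + 1/x the equation is quadratic; the last hypothesis excludes
   that x + 1/x and y + 1/y are its two distinct roots. *)
Lemma degenerate_quartic_inj s q x y : s != 0 ->
  s * (x + 1) ^+ 2 * (x ^+ 2 + 1) = q * x ^+ 2 ->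
  s * (y + 1) ^+ 2 * (y ^+ 2 + 1) = q * y ^+ 2 ->
  x ^+ 2 * y + y + (y ^+ 2 * x + x) + (x * y + x * y) != 0 ->
  x = y \/ x * y = 1.
Proof.
move=> s0 hx hy h6.
have : s * (x - y) * (x * y - 1) * (x ^+ 2 * y + y + (y ^+ 2 * x + x) + (x * y + x * y)) = 0.
  transitivity (y ^+ 2 * (s * (x + 1) ^+ 2 * (x ^+ 2 + 1)) - x ^+ 2 * (s * (y + 1) ^+ 2 * (y ^+ 2 + 1))).
    ring.
  rewrite hx hy; ring.
move/eqP; rewrite !mulf_eq0 (negPf s0) (negPf h6) orbF !subr_eq0 => /orP[/eqP|/eqP]; auto.
Qed.

(** If x = y, both m and n equal q / (1 - x^4). If x y = 1, multiplying m x^4 = m - q and n y^4 = n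
    - q gives m n = (m - q) (n - q), whence q (m + n) = q^2. *)
Lemma degenerate_level_unique s q m n x y : s != 0 -> q != 0 -> x != 0 -> y != 0 ->
  x ^+ 2 * y + y + (y ^+ 2 * x + x) + (x * y + x * y) != 0 ->
  x ^+ 4 != 1 ->
  cubic m s q x = 0 -> m * x ^+ 4 + (q - m) = 0 ->
  cubic n s q y = 0 -> n * y ^+ 4 + (q - n) = 0 ->
  m = n \/ m + n = q.
Proof.
move=> s0 q0 x0 y0 h6 x4 cx dx cy dy.
have [e|e] := degenerate_quartic_inj s0 (degenerate_quartic x0 cx dx) (degenerate_quartic y0 cy dy) h6.
  left; apply: (mulIf (_ : x ^+ 4 - 1 != 0)); first by rewrite subr_eq0.
  rewrite -e in dy; apply/eqP; rewrite -subr_eq0; apply/eqP.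
  transitivity ((m * x ^+ 4 + (q - m)) - (n * x ^+ 4 + (q - n))); first ring.
  by rewrite dx dy subrr.
right; apply: (mulfI q0); apply/eqP; rewrite -subr_eq0; apply/eqP.
transitivity (m * n - (m - q) * (n - q)); first ring.
have -> : m - q = m * x ^+ 4 by apply/eqP; rewrite -subr_eq0 -oppr_eq0 -dx; apply/eqP; ring.
have -> : n - q = n * y ^+ 4 by apply/eqP; rewrite -subr_eq0 -oppr_eq0 -dy; apply/eqP; ring.
transitivity (m * n * (1 - (x * y) ^+ 4)); first ring.
by rewrite e; ring.
Qed.

End CubicIdentities.

(** * Roots of the cubic congruent to 1 *)

Section NearOne.
Variables (p : nat) (p_pr : prime p) (p_gt3 : (3 < p)%N).
Local Notation Qp := (padic p_pr).
Local Notation nm := (@padic_norm p p_pr).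
Local Notation r := ((p%:R : rat)^-1).

Definition near1 (x : Qp) := nm (x - 1) < 1.

Lemma near1_norm x : near1 x -> nm x = 1.
Proof. by move=> h; rewrite -(padic_norm1 p_pr); apply: padic_norm_eq_lt; rewrite padic_norm1. Qed.

Lemma near1_neq0 x : near1 x -> x != 0.
Proof. by move=> /near1_norm h; rewrite -padic_norm_eq0 h oner_eq0. Qed.

Lemma near1_1 : near1 1.
Proof. by rewrite /near1 subrr padic_norm0 ltr01. Qed.

Lemma near1M x y : near1 x -> near1 y -> near1 (x * y).
Proof.
move=> hx hy; rewrite /near1 -(subrKA y) -{2}[y]mul1r -mulrBl.
apply: padic_normD_lt; last exact: hy.
rewrite padic_normM (near1_norm hy) mulr1; exact: hx.
Qed.

Lemma near1X x n : near1 x -> near1 (x ^+ n).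
Proof. by move=> hx; elim: n => [|n IH]; [exact: near1_1|rewrite exprS near1M]. Qed.

(** Congruence to an integer modulo p: a sum of j elements near 1 is congruent to j, hence nonzero
    when p does not divide j. *)
Definition near_nat k (x : Qp) := nm (x - k%:R) < 1.

Lemma near_nat1 x : near1 x -> near_nat 1 x.
Proof. by rewrite /near_nat mulr1n. Qed.

Lemma near_nat_neq0 (x : Qp) k : ~~ (p %| k)%N -> near_nat k x -> x != 0.
Proof.
move=> /padic_norm_nat_unit k1 h; rewrite -padic_norm_eq0.
by rewrite (@padic_norm_eq_lt _ _ x k%:R) k1 ?oner_eq0.
Qed.

Lemma near_natD (x y : Qp) j k : near_nat j x -> near_nat k y -> near_nat (j + k) (x + y).
Proof. by move=> hx hy; rewrite /near_nat natrD opprD addrACA padic_normD_lt. Qed.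

Lemma prime_ndvd_lt n : (0 < n < p)%N -> ~~ (p %| n)%N.
Proof. by move=> /andP[n0 np]; rewrite gtnNdvd. Qed.

Lemma p_ndvd4 : ~~ (p %| 4)%N.
Proof.
by rewrite (_ : 4 = 2 * 2)%N // Euclid_dvdM // negb_or !prime_ndvd_lt //= ltnW.
Qed.

Lemma p_ndvd6 : ~~ (p %| 6)%N.
Proof. by rewrite (_ : 6 = 2 * 3)%N // Euclid_dvdM // negb_or !prime_ndvd_lt //= ltnW. Qed.

Lemma near1_cube_neq1 x : near1 x -> x != 1 -> x ^+ 3 != 1.
Proof.
move=> hx x1; rewrite -subr_eq0 subrX1 !big_ord_recl big_ord0 addr0 expr0 expr1.
rewrite mulf_neq0 ?subr_eq0 //; apply: (@near_nat_neq0 _ (1 + (1 + 1))); first by rewrite prime_ndvd_lt.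
apply: near_natD; first exact/near_nat1/near1_1.
by apply: near_natD; apply: near_nat1; last exact: near1X.
Qed.

(** The cofactor of x - y in x^4 - y^4 is congruent to 4, so it does not vanish. *)
Lemma near1_pow4_inj x y : near1 x -> near1 y -> x ^+ 4 = y ^+ 4 -> x = y.
Proof.
move=> hx hy /eqP; rewrite -subr_eq0 subrXX mulf_eq0 subr_eq0 => /orP[/eqP //|/eqP].
rewrite !big_ord_recl big_ord0 addr0 => /eqP/negPn/negP []; apply: (@near_nat_neq0 _ (1 + (1 + (1 + 1)))).
  exact: p_ndvd4.
have h i j : near_nat 1 (x ^+ i * y ^+ j) by apply/near_nat1/near1M; exact: near1X.
by do 3 (apply: near_natD; first exact: h); exact: h.
Qed.

(** 3 m is a unit since p > 3, so [cubic_step] maps the open unit ball to itself and its difference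
    quotient has norm below 1, hence at most 1/p. *)
Lemma cubic_root_near1 (m s q : Qp) : nm m = 1 -> nm s < 1 -> nm q < 1 ->
  exists2 x, near1 x & cubic m s q x = 0.
Proof.
move=> m1 s1 q1.
have m0 : m != 0 by rewrite -padic_norm_eq0 m1 oner_eq0.
have n3 : nm 3%:R = 1 by rewrite padic_norm_nat_unit // prime_ndvd_lt.
have i3m : nm (3%:R * m)^-1 <= 1 by rewrite padic_normV padic_normM n3 m1 mulr1 invr1.
have h3 : 3%:R != 0 :> Qp by rewrite -padic_norm_eq0 n3 oner_eq0.
have n1 y : nm y < 1 -> nm (1 + y) = 1.
  by move=> hy; apply: near1_norm; rewrite /near1 addrAC subrr add0r.
have sm (x y : Qp) : nm x < 1 -> nm y <= 1 -> nm (x * y) < 1.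
  by move=> hx hy; rewrite padic_normM (le_lt_trans _ hx) // ler_piMr ?padic_norm_ge0.
have [y y1|a b a1 b1|y y1 /(cubic_step_fixed m0 h3) hy] := @padic_contraction _ p_pr (cubic_step m s q).
- apply: padic_normB_lt; last by rewrite padic_normM padic_normV n3 invr1 mulr1 exprS sm // expr2 ltW // sm // ltW.
  apply: padic_normB_lt; last by rewrite expr2 sm // ltW.
  apply: (sm _ _ _ i3m).
  apply: padic_normB_lt => //; rewrite -mulrA; apply: (sm _ _ s1); rewrite padic_normM n1 // mul1r.
  by rewrite padic_normD_le ?padic_norm_nat_le1 // ltW.
- rewrite cubic_step_diff // padic_normM mulrC ler_wpM2r ?padic_norm_ge0 // padic_norm_lt1 //.
  have i3 : nm (3%:R)^-1 <= 1 by rewrite padic_normV n3 invr1.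
  apply: padic_normB_lt; last first.
    apply: (sm _ _ _ i3); rewrite !expr2; apply: padic_normD_lt; last exact: (sm _ _ b1 (ltW b1)).
    apply: padic_normD_lt; [exact: (sm _ _ a1 (ltW a1))|exact: (sm _ _ a1 (ltW b1))].
  apply: padic_normB_lt; last exact: padic_normD_lt a1 b1.
  apply: (sm _ _ _ i3m); apply: (sm _ _ s1); apply: padic_normD_le (ltW b1).
  by apply: padic_normD_le (ltW a1); rewrite n3.
by exists (1 + y) => //; rewrite /near1 addrAC subrr add0r.
Qed.

Lemma degenerate_level_unique_near1 (s q m n x y : Qp) : s != 0 -> q != 0 ->
  near1 x -> near1 y -> cubic m s q 1 != 0 ->
  cubic m s q x = 0 -> m * x ^+ 4 + (q - m) = 0 ->
  cubic n s q y = 0 -> n * y ^+ 4 + (q - n) = 0 ->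
  m = n \/ m + n = q.
Proof.
move=> s0 q0 hx hy c1 cx dx; apply: (degenerate_level_unique s0 q0 (near1_neq0 hx) (near1_neq0 hy) _ _ cx dx).
  (* Six products of elements near 1 are added, so the sum is congruent to 6. *)
  apply: (@near_nat_neq0 _ (1 + 1 + (1 + 1) + (1 + 1))); first exact: p_ndvd6.
  by apply: near_natD; [apply: near_natD|]; apply: near_natD; apply: near_nat1; rewrite ?near1M ?near1X.
apply: contra_neq c1 => x4; suff -> : 1 = x by [].
by apply: near1_pow4_inj => //; [exact: near1_1|rewrite expr1n x4].
Qed.

End NearOne.

(** * Finite balls of the tree *)

Section Tree.
Variable k : nat.
Local Notation ball := (ball_vertices k).

Definition ball_word n (x : ball n) : seq 'I_k.+1 := vertex_word x.

Lemma ball_wordE n (x : ball n) : vertex_word x = ball_word x.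
Proof. by []. Qed.

Lemma size_ball n (x : ball n) : (size (ball_word x) <= n)%N.
Proof. exact: size_bseq (val x). Qed.

Lemma ball_reduced n (x : ball n) : reduced (ball_word x).
Proof. exact: (valP x). Qed.

Lemma ball_word_inj n (x y : ball n) : ball_word x = ball_word y -> x = y.
Proof. by move=> h; do 2 apply: val_inj. Qed.

Definition mk_ball n (s : seq 'I_k.+1) (hs : (size s <= n)%N) (hr : reduced s) : ball n :=
  exist (fun x : {bseq n of 'I_k.+1} => reduced x) (Bseq hs) hr.

Lemma reduced_behead s : @reduced k s -> reduced (behead s).
Proof. by case: s => // a s /path_sorted. Qed.

Lemma reduced_take n s : @reduced k s -> reduced (take n s).
Proof. exact: take_sorted. Qed.

Lemma size_behead_le n (s : seq 'I_k.+1) : (size s <= n.+1)%N -> (size (behead s) <= n)%N.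
Proof. by rewrite size_behead -subn1 leq_subLR add1n. Qed.

Lemma size_take_le n (s : seq 'I_k.+1) : (size (take n s) <= n)%N.
Proof. by rewrite size_take_min geq_minl. Qed.

Definition ball_parent n (y : ball n.+1) : ball n :=
  mk_ball (size_behead_le (size_ball y)) (reduced_behead (ball_reduced y)).

(** A total retraction of [ball_widen], for reindexing. On the sphere it drops the last letter, so
    there it need not give the parent, unlike [ball_parent]. *)
Definition ball_shrink n (y : ball n.+1) : ball n :=
  mk_ball (size_take_le n (ball_word y)) (reduced_take n (ball_reduced y)).

Lemma ball_parentE n (y : ball n.+1) : ball_word (ball_parent y) = behead (ball_word y).
Proof. by []. Qed.

Lemma ball_shrinkE n (y : ball n.+1) : ball_word (ball_shrink y) = take n (ball_word y).
Proof. by []. Qed.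

Lemma ball_widenE n (x : ball n) : ball_word (ball_widen x) = ball_word x.
Proof. by []. Qed.

Lemma ball_widenK n : cancel (@ball_widen k n) (@ball_shrink n).
Proof. by move=> x; apply: ball_word_inj; rewrite ball_shrinkE; exact: take_oversize (size_ball x). Qed.

Lemma ball_shrinkK n (y : ball n.+1) : size y != n.+1 -> ball_widen (ball_shrink y) = y.
Proof.
move=> h; apply: ball_word_inj; rewrite ball_widenE ball_shrinkE take_oversize //.
by have := size_ball y; rewrite leq_eqVlt (negPf h).
Qed.

Lemma size_ball_neq n (x : ball n) : size x != n.+1.
Proof. by rewrite neq_ltn ltnS size_ball. Qed.

Lemma ball_successorP n (x y : ball n) : reflect (exists i, ball_word y = i :: ball_word x) (successor x y).
Proof. exact: successorP. Qed.

Lemma successor_parent n (x y : ball n.+1) : size y = n.+1 -> successor x y = (x == ball_widen (ball_parent y)).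
Proof.
move=> sy; apply/ball_successorP/eqP => [[i e]|->].
  by apply: ball_word_inj; rewrite ball_widenE ball_parentE e.
rewrite ball_widenE ball_parentE; move: sy; rewrite ball_wordE.
by case: (ball_word y) => // i s _; exists i.
Qed.

Section BigOps.
Variables (R : Type) (idx : R) (op : Monoid.com_law idx).

Lemma big_ball_widen n (F : ball n.+1 -> R) :
  \big[op/idx]_(y : ball n.+1 | size y != n.+1) F y = \big[op/idx]_(x : ball n) F (ball_widen x).
Proof.
rewrite (reindex_onto (@ball_widen k n) (@ball_shrink n)) => [|y /ball_shrinkK //].
by apply: eq_bigl => x; rewrite ball_widenK eqxx andbT size_ball_neq.
Qed.

Lemma big_successor_widen n (y : ball n) (F : ball n.+1 -> R) :
  \big[op/idx]_(x : ball n.+1 | successor x (ball_widen y)) F x =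
  \big[op/idx]_(x : ball n | successor x y) F (ball_widen x).
Proof.
rewrite (reindex_onto (@ball_widen k n) (@ball_shrink n)) => [|x].
  by apply: eq_bigl => x; rewrite ball_widenK eqxx andbT.
move=> /successor_size e; apply: ball_shrinkK.
by have := size_ball y; rewrite -ball_widenE -ball_wordE e neq_ltn ltnS => /ltnW ->.
Qed.

(** Edges are sorted by their farther endpoint: inside the smaller ball they are edges of that ball,
    on the sphere they join a vertex to its parent. *)
Lemma big_edges_ballS n (f : ball n.+1 -> ball n.+1 -> R) :
  \big[op/idx]_(x : ball n.+1) \big[op/idx]_(y : ball n.+1 | successor x y) f x y =
  op (\big[op/idx]_(x : ball n) \big[op/idx]_(y : ball n | successor x y) f (ball_widen x) (ball_widen y))
     (\big[op/idx]_(y : ball n.+1 | size y == n.+1) f (ball_widen (ball_parent y)) y).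
Proof.
rewrite (exchange_big_dep predT) //= (bigID (fun y : ball n.+1 => size y != n.+1)) /=; congr (op _ _).
  rewrite big_ball_widen [RHS](exchange_big_dep predT) //=.
  by apply: eq_bigr => y _; rewrite big_successor_widen.
under eq_bigl => y do rewrite negbK.
by apply: eq_bigr => y /eqP sy; rewrite (eq_bigl _ _ (fun x => successor_parent x sy)) big_pred1_eq.
Qed.

(** If [i] repeats the first letter, the default is [x] itself, whose length is not [n.+1], so the
    filter by length discards it. *)
Definition ball_child n (x : ball n) (i : 'I_k.+1) : ball n.+1 :=
  insubd (ball_widen x) (@Bseq n.+1 'I_k.+1 (i :: ball_word x) (size_ball x)).

Lemma ball_childE n (x : ball n) i : ball_word (ball_child x i) =
  if reduced (i :: ball_word x) then i :: ball_word x else ball_word x.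
Proof.
transitivity (bseqval (val (ball_child x i))); first by [].
by rewrite /ball_child val_insubd /=; case: ifP.
Qed.

Lemma big_children n (x : ball n) (F : ball n.+1 -> R) : size x = n ->
  \big[op/idx]_(y : ball n.+1 | (size y == n.+1) && (ball_parent y == x)) F y =
  \big[op/idx]_(i | reduced (i :: ball_word x)) F (ball_child x i).
Proof.
move=> sx; rewrite (reindex_onto (ball_child x) (fun y => head ord0 (ball_word y))).
  apply: eq_bigl => i; rewrite ball_wordE ball_childE; case: ifP => h /=.
    rewrite -ball_wordE sx !eqxx andbT /=; apply/eqP/ball_word_inj.
    by rewrite ball_parentE ball_childE h.
  by rewrite (negPf (size_ball_neq x)).
move=> y /andP[/eqP sy /eqP <-]; apply: ball_word_inj; rewrite ball_childE ball_parentE.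
have := ball_reduced y; move: sy; rewrite ball_wordE.
by case: (ball_word y) => // i s _ /= ->.
Qed.
End BigOps.

Lemma card_children n (x : ball n) : size x = n -> (0 < n)%N ->
  #|[pred i | reduced (i :: ball_word x)]| = k.
Proof.
rewrite ball_wordE => sx n0; have := ball_reduced x.
case: (ball_word x) sx => [e|a s _ rx]; first by rewrite -e in n0.
rewrite -[RHS](_ : #|predC1 a| = k); last by rewrite cardC1 card_ord.
apply: eq_card => i; rewrite !inE /reduced /=.
by move: rx; rewrite /reduced /= => ->; rewrite andbT.
Qed.

Lemma card_root_children (x : ball 0) : #|[pred i | reduced (i :: ball_word x)]| = k.+1.
Proof.
have := size_ball x; case: (ball_word x) => // _.
by rewrite -[RHS]card_ord; apply: eq_card => i; rewrite !inE.
Qed.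

(** [d] is a parameter because the root has [k.+1] children and every other vertex [k]. *)
Lemma prod_sphereS (R : comNzRingType) n (f : ball n -> R) (d : nat) :
  (forall x : ball n, size x = n -> #|[pred i | reduced (i :: ball_word x)]| = d) ->
  \prod_(y : ball n.+1 | size y == n.+1) f (ball_parent y) =
  \prod_(x : ball n | size x == n) f x ^+ d.
Proof.
move=> hd; rewrite (partition_big (@ball_parent n) (fun x : ball n => size x == n)) /=.
  apply: eq_bigr => x /eqP sx; rewrite -(hd x sx) -prodr_const.
  rewrite -(@big_children _ _ _ _ x (fun=> f x)) //.
  by apply: eq_bigr => y /andP[_ /eqP ->].
move=> y /eqP sy; change (size (behead (ball_word y)) == n).
by rewrite size_behead -[size _]/(size y) sy.
Qed.

End Tree.

(** * Gibbs measures from boundary laws *)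

Section BoundaryLaw.
Variables (p : nat) (p_pr : prime p) (p_gt3 : (3 < p)%N) (k q : nat).
Local Notation Qp := (padic p_pr).
Local Notation nm := (@padic_norm p p_pr).
Local Notation ball := (ball_vertices k).
Local Notation config n := {ffun ball_vertices k n -> 'I_q}.
Variables (J : Qp) (J1 : nm J < 1) (eta : 'I_q -> Qp) (eta1 : forall i, nm (eta i) < 1).

Local Notation theta := (padic_exp J).
Local Notation z i := (padic_exp (eta i)).
Local Notation h := (fun (_ : vertex k) (i : 'I_q) => eta i).

(** Total weight of one boundary vertex whose parent has spin [s]. The boundary law equation,
    [transferP] below, makes its k-th power proportional to [z s]. *)
Definition transfer (s : 'I_q) : Qp := \sum_t theta ^+ (s == t) * z t.

Lemma padic_norm_sum_lt1 I (s : seq I) (P : pred I) (F : I -> Qp) :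
  (forall i, nm (F i) < 1) -> nm (\sum_(i <- s | P i) F i) < 1.
Proof.
move=> hF; elim/big_ind: _ => [|x y|//]; first by rewrite padic_norm0.
exact: padic_normD_lt.
Qed.

Definition edge_weight n (tau : config n) : Qp :=
  \prod_(x : ball n) \prod_(y : ball n | successor x y) theta ^+ (tau x == tau y).

Lemma gibbs_weightE n (tau : config n) :
  gibbs_weight J h tau = edge_weight tau * \prod_(x : ball n | size x == n) z (tau x).
Proof.
have J1' (b : bool) : nm (J *+ b) < 1 by case: b; rewrite ?padic_norm0.
rewrite /gibbs_weight /hamiltonian mulr_sumr.
under eq_bigr => x _ do (rewrite mulr_sumr; under eq_bigr => y _ do rewrite mulr_natr).
rewrite padic_expD ?padic_exp_sum //; first last.
- exact: padic_norm_sum_lt1.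
- by apply: padic_norm_sum_lt1 => x; exact: padic_norm_sum_lt1.
- by move=> x; exact: padic_norm_sum_lt1.
congr (_ * _); apply: eq_bigr => x _; rewrite padic_exp_sum //.
by apply: eq_bigr => y _; rewrite padic_expMn.
Qed.

Lemma edge_weightS n (tau : config n.+1) : edge_weight tau = edge_weight (restrictS tau) *
  \prod_(y : ball n.+1 | size y == n.+1) theta ^+ (restrictS tau (ball_parent y) == tau y).
Proof.
rewrite /edge_weight big_edges_ballS; congr (_ * _).
  by apply: eq_bigr => x _; apply: eq_bigr => y _; rewrite !ffunE.
by apply: eq_bigr => y _; rewrite !ffunE.
Qed.

(** Puts the extensions of [sigma] into the form of one condition per vertex, to which
    distributivity of products over sums applies. *)
Lemma restrictSP n (tau : config n.+1) (sigma : config n) :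
  (restrictS tau == sigma) =
  (tau \in family (fun y : ball n.+1 => [pred s : 'I_q | (size y == n.+1) || (s == sigma (ball_shrink y))])).
Proof.
apply/eqP/familyP => [<- y|hf].
  rewrite inE ffunE; have [//|/ball_shrinkK ->] := eqVneq.
  by rewrite eqxx.
apply/ffunP => x; rewrite ffunE; have := hf (ball_widen x).
by rewrite inE (negPf (size_ball_neq x)) ball_widenK => /eqP.
Qed.

(** Given [sigma], the spins on the new sphere are independent, so the sum factors over its
    vertices. *)
Lemma sum_extensions n (sigma : config n) :
  \sum_(tau : config n.+1 | restrictS tau == sigma) gibbs_weight J h tau =
  edge_weight sigma * \prod_(y : ball n.+1 | size y == n.+1) transfer (sigma (ball_parent y)).
Proof.
pose g (y : ball n.+1) (s : 'I_q) : Qp :=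
  if size y == n.+1 then theta ^+ (sigma (ball_parent y) == s) * z s else 1.
transitivity (\sum_(tau : config n.+1 | restrictS tau == sigma) edge_weight sigma * \prod_y g y (tau y)).
  apply: eq_bigr => tau; rewrite /g => /eqP <-; rewrite gibbs_weightE edge_weightS -mulrA; congr (_ * _).
  by rewrite -big_split /= big_mkcond.
rewrite -mulr_sumr (eq_bigl _ _ (fun tau => restrictSP tau sigma)); congr (_ * _).
rewrite -(bigA_distr_big_dep (fun y : ball n.+1 => [pred s : 'I_q | (size y == n.+1) || (s == sigma (ball_shrink y))])).
rewrite [RHS]big_mkcond; apply: eq_bigr => y _ /=; rewrite /g; case: ifP => _ //=.
by rewrite big_pred1_eq.
Qed.

Variables (C : Qp) (C0 : C != 0) (transferP : forall s, transfer s ^+ k = C * z s).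

Lemma sum_extensions_pos n (sigma : config n) : (0 < n)%N ->
  \sum_(tau : config n.+1 | restrictS tau == sigma) gibbs_weight J h tau =
  C ^+ #|[pred x : ball n | size x == n]| * gibbs_weight J h sigma.
Proof.
move=> n0; rewrite sum_extensions (@prod_sphereS _ _ _ (fun x => transfer (sigma x)) k).
  by rewrite gibbs_weightE mulrCA -prodr_const -big_split /=; congr (_ * _); apply: eq_bigr.
by move=> x sx; exact: card_children.
Qed.

Lemma partition_functionS n : (0 < n)%N ->
  partition_function (k := k) J h n.+1 = C ^+ #|[pred x : ball n | size x == n]| * partition_function J h n.
Proof.
move=> n0; rewrite /partition_function (partition_big (@restrictS k q n) predT) //= mulr_sumr.
by apply: eq_bigr => sigma _; exact: sum_extensions_pos.
Qed.

(** The root has [k.+1] children, so this power differs from the one in the boundary law, and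
    nonvanishing becomes the separate hypothesis [Z1]. *)
Lemma partition_function1 : partition_function (k := k) J h 1 = \sum_s transfer s ^+ k.+1.
Proof.
rewrite /partition_function (partition_big (@restrictS k q 0) predT) //=.
pose o : ball 0 := @mk_ball k 0 [::] isT isT.
have allo (x : ball 0) : x = o.
  by apply: (@ball_word_inj k 0 x o); have := size_ball x; case: (ball_word x).
rewrite (reindex (fun s : 'I_q => [ffun=> s] : config 0)) /=; last first.
  exists (fun sigma : config 0 => sigma o) => [s _|sigma _]; first by rewrite ffunE.
  by apply/ffunP => x; rewrite ffunE (allo x).
apply: eq_bigr => s _; rewrite sum_extensions (@prod_sphereS _ _ _ (fun x => transfer ([ffun=> s] x)) k.+1).
  rewrite (eq_bigl (pred1 o)) => [|x]; last by rewrite (allo x) eqxx.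
  rewrite big_pred1_eq ffunE /edge_weight big1 ?mul1r // => x _; rewrite big_pred0 // => y.
  by rewrite (allo x) (allo y); apply/negbTE/negP => e; have /n_Sn := successor_size e.
by move=> x _; exact: card_root_children.
Qed.

Hypothesis Z1 : \sum_s transfer s ^+ k.+1 != 0.

Lemma partition_function_neq0 n : (1 <= n)%N -> partition_function (k := k) J h n != 0.
Proof.
elim: n => // -[|n] IH _; first by rewrite partition_function1.
by rewrite partition_functionS // mulf_neq0 ?expf_neq0 // IH.
Qed.

Lemma boundary_law_compatible : compatible (k := k) J h.
Proof.
move=> n n1 sigma; rewrite /gibbs_finite -mulr_suml sum_extensions_pos // partition_functionS //.
by rewrite -mulf_div divff ?mul1r // expf_neq0.
Qed.

End BoundaryLaw.

(** * From compatible weights to a measure on cylinder sets *)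

Section CylinderMeasure.
Variables (p : nat) (p_pr : prime p) (k q : nat).
Local Notation Qp := (padic p_pr).
Local Notation ball := (ball_vertices k).
Local Notation config n := {ffun ball_vertices k n -> 'I_q}.
Local Notation restrict := Defs.restrict.
Local Notation state := (vertex k -> 'I_q).
Variables (g : forall n, config n -> Qp).
Hypothesis g_compat : forall n, (1 <= n)%N -> forall sigma : config n,
  \sum_(tau : config n.+1 | restrictS tau == sigma) g tau = g sigma.
Hypothesis g_total : \sum_(tau : config 1) g tau = 1.

Definition ball_truncate n (v : vertex k) : ball n :=
  mk_ball (size_take_le n v) (reduced_take n (vertex_reduced v)).

Definition extend n (tau : config n) : state := fun v => tau (ball_truncate n v).

Lemma restrict_extend n (tau : config n) : restrict n (extend tau) = tau.
Proof.
apply/ffunP => x; rewrite ffunE /extend; congr (tau _); apply: ball_word_inj.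
exact: take_oversize (size_ball x).
Qed.

Lemma restrictS_restrict n (s : state) : restrictS (restrict n.+1 s) = restrict n s.
Proof. by apply/ffunP => x; rewrite !ffunE; congr (s _); exact: val_inj. Qed.

Definition cylinder_level n (A : set state) :=
  exists B : {set config n}, A = [set s | restrict n s \in B].

Lemma cylinder_levelS n A : cylinder_level n A -> cylinder_level n.+1 A.
Proof.
move=> [B ->]; exists [set tau | restrictS tau \in B]%SET.
by apply/seteqP; split=> s /=; rewrite inE restrictS_restrict.
Qed.

Lemma cylinder_level_leq n m A : (n <= m)%N -> cylinder_level n A -> cylinder_level m A.
Proof.
move=> nm hA; rewrite -(subnK nm); elim: (m - n)%N => // i; exact: cylinder_levelS.
Qed.

(** A set of level [n] contains all configurations restricting to [tau] or none, so testing the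
    representative [extend tau] decides. *)
Definition level_measure n (A : set state) : Qp :=
  \sum_(tau : config n | `[< A (extend tau) >]) g tau.

Lemma level_measureS n A : (1 <= n)%N -> cylinder_level n A ->
  level_measure n.+1 A = level_measure n A.
Proof.
move=> n1 [B ->]; rewrite /level_measure.
rewrite (partition_big (@restrictS k q n) (fun sigma => `[< restrict n (extend sigma) \in B >])) /=.
  apply: eq_bigr => sigma /asboolP; rewrite restrict_extend => sB.
  rewrite -g_compat //; apply: eq_bigl => tau; rewrite andbC.
  case: eqP => //= e; rewrite -restrictS_restrict restrict_extend e.
  exact/asboolP.
by move=> tau /asboolP h; apply/asboolP; rewrite restrict_extend -[tau]restrict_extend restrictS_restrict.
Qed.

Lemma level_measure_leq n m A : (1 <= n)%N -> (n <= m)%N -> cylinder_level n A ->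
  level_measure m A = level_measure n A.
Proof.
move=> n1 nm hA; rewrite -(subnK nm); elim: (m - n)%N => // i IH.
rewrite addSn level_measureS // ?(leq_trans n1) ?leq_addl //.
by apply: cylinder_level_leq hA; rewrite leq_addl.
Qed.

Lemma cylinder_has_level (A : @cylinders k q) : exists n, cylinder_level n (val A).
Proof. exact: set_mem (valP A). Qed.

(** The successor keeps the level at least 1, where compatibility is available; [cylinder_measureE]
    gives independence of the chosen level. *)
Definition cylinder_measure (A : @cylinders k q) : Qp :=
  level_measure (projT1 (cid (cylinder_has_level A))).+1 (val A).

Lemma cylinder_measureE n (A : @cylinders k q) : (1 <= n)%N -> cylinder_level n (val A) ->
  cylinder_measure A = level_measure n (val A).
Proof.
move=> n1 hA; rewrite /cylinder_measure; case: cid => m /= hm.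
rewrite -(@level_measure_leq m.+1 (maxn m.+1 n)) ?leq_maxl //; last exact: cylinder_levelS.
by rewrite -(@level_measure_leq n (maxn m.+1 n)) ?leq_maxr.
Qed.

Lemma cylinder_measure_config n (tau : config n) (A : @cylinders k q) : (1 <= n)%N ->
  val A = [set s | restrict n s = tau] -> cylinder_measure A = g tau.
Proof.
move=> n1 eA; rewrite (@cylinder_measureE n) //; last first.
  by exists [set tau]%SET; rewrite eA; apply/seteqP; split => s /=; rewrite inE => /eqP.
rewrite eA /level_measure (eq_bigl (pred1 tau)) ?big_pred1_eq // => s /=.
by rewrite restrict_extend; apply/asboolP/eqP.
Qed.

Lemma cylinder_measure_probability : padic_probability cylinder_measure.
Proof.
split=> [A B C dAB eC|A eA]; last first.
  rewrite (@cylinder_measureE 1) //.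
    by rewrite -g_total eA /level_measure; apply: eq_bigl => tau; apply/asboolP.
  by exists finset.setT; rewrite eA; apply/seteqP; split => s //=; rewrite inE.
have [a ha] := cylinder_has_level A; have [b hb] := cylinder_has_level B.
have [c hc] := cylinder_has_level C; pose n := (a + b + c).+1.
have hA : cylinder_level n (val A) by apply: cylinder_level_leq ha; lia.
have hB : cylinder_level n (val B) by apply: cylinder_level_leq hb; lia.
have hC : cylinder_level n (val C) by apply: cylinder_level_leq hc; lia.
rewrite !(@cylinder_measureE n) // /level_measure (bigID (fun tau : config n => `[< val A (extend tau) >])) /=.
congr (_ + _); apply: eq_bigl => tau; apply/andP/asboolP.
- by case=> _ /asboolP.
- by move=> h; split; apply/asboolP => //; rewrite eC; left.
- by rewrite eC => -[/asboolP [//|] h /asboolP].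
move=> h; split; first by apply/asboolP; rewrite eC; right.
by apply/asboolP => h'; suff : (val A `&` val B) (extend tau) by rewrite dAB.
Qed.

End CylinderMeasure.

(** * Existence of Gibbs measures and recovery of the boundary law *)

Section GibbsMeasure.
Variables (p : nat) (p_pr : prime p) (k q : nat).
Local Notation Qp := (padic p_pr).
Local Notation config n := {ffun ball_vertices k n -> 'I_q}.
Local Notation restrict := Defs.restrict.

Lemma gibbs_measure_exists (J : Qp) (h : vertex k -> 'I_q -> Qp) :
  (forall x i, in_exp_domain (h x i)) ->
  (forall n, (1 <= n)%N -> partition_function J h n != 0) ->
  compatible J h -> exists mu, gibbs_measure_of J h mu.
Proof.
move=> h1 Z0 hc; exists (cylinder_measure (fun n => @gibbs_finite _ p_pr _ _ J h n)).
have total : \sum_(tau : config 1) gibbs_finite J h tau = 1.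
  by rewrite -mulr_suml divff // Z0.
split => //; first exact: cylinder_measure_probability.
by move=> n n1 tau A; exact: cylinder_measure_config.
Qed.

Lemma gibbs_measure_finite (J : Qp) h h' (mu : @cylinders k q -> Qp) n (tau : config n) :
  (1 <= n)%N -> gibbs_measure_of J h mu -> gibbs_measure_of J h' mu ->
  gibbs_finite J h tau = gibbs_finite J h' tau.
Proof.
move=> n1 [_ _ _ _ e] [_ _ _ _ e'].
have cA : @cylinders k q [set s | restrict n s = tau].
  by exists n, [set tau]%SET; apply/seteqP; split => s /=; rewrite inE => /eqP.
pose A : @cylinders k q := SigSub (mem_set cA).
by rewrite -(e n n1 tau A) // -(e' n n1 tau A).
Qed.

Hypothesis p_gt3 : (3 < p)%N.

Lemma gibbs_weight_const (J : Qp) (eta : 'I_q -> Qp) (a : 'I_q) :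
  padic_norm J < 1 -> (forall i, padic_norm (eta i) < 1) ->
  gibbs_weight J (fun _ i => eta i) ([ffun=> a] : config 1) =
  edge_weight J ([ffun=> a] : config 1) * padic_exp (eta a) ^+ k.+1.
Proof.
move=> J1 eta1; rewrite gibbs_weightE //; congr (_ * _).
under eq_bigr => x _ do rewrite ffunE.
rewrite (@prod_sphereS k _ 0 (fun=> padic_exp (eta a)) k.+1); last first.
  by move=> x _; exact: card_root_children.
pose o : ball_vertices k 0 := @mk_ball k 0 [::] isT isT.
rewrite (eq_bigl (pred1 o)) ?big_pred1_eq // => x.
have -> : x = o by apply: ball_word_inj; have := size_ball x; case: (ball_word x).
by rewrite /= !eqxx.
Qed.

Lemma edge_weight_const n (J : Qp) (a b : 'I_q) :
  edge_weight J ([ffun=> a] : config n) = edge_weight J ([ffun=> b] : config n).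
Proof. by apply: eq_bigr => x _; apply: eq_bigr => y _; rewrite !ffunE !eqxx. Qed.

Lemma edge_weight_neq0 n (J : Qp) (tau : config n) : padic_norm J < 1 -> edge_weight J tau != 0.
Proof.
move=> J1; apply/prodf_neq0 => x _; apply/prodf_neq0 => y _.
by rewrite expf_neq0 // padic_exp_neq0.
Qed.

End GibbsMeasure.

Lemma cross_ratio (F : fieldType) (w Z Z' a a' b b' : F) : w != 0 -> Z != 0 -> Z' != 0 ->
  w * a / Z = w * a' / Z' -> w * b / Z = w * b' / Z' -> a * b' = a' * b.
Proof.
move=> w0 Z0 Z0'; rewrite -!mulrA => /(mulfI w0) ha /(mulfI w0) hb.
apply: (mulIf (_ : (Z * Z')^-1 != 0)); first by rewrite invr_eq0 mulf_neq0.
by rewrite -mulf_div ha -hb mulf_div [Z' * Z]mulrC.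
Qed.

(** Constant configurations on the ball of radius 1 share their edge weight and have boundary factor
    z^4. Their probabilities give the identity for fourth powers, which are injective near 1. *)
Lemma gibbs_measure_inj p (p_pr : prime p) q (J : padic p_pr) (eta eta' : 'I_q -> padic p_pr) mu :
  (3 < p)%N -> padic_norm J < 1 ->
  (forall i, padic_norm (eta i) < 1) -> (forall i, padic_norm (eta' i) < 1) ->
  gibbs_measure_of (k := 3) J (fun _ i => eta i) mu ->
  gibbs_measure_of (k := 3) J (fun _ i => eta' i) mu ->
  forall a b, padic_exp (eta a) * padic_exp (eta' b) = padic_exp (eta' a) * padic_exp (eta b).
Proof.
move=> p_gt3 J1 e1 e1' hmu hmu' a b.
have n1 (eta0 : 'I_q -> padic p_pr) : (forall i, padic_norm (eta0 i) < 1) -> forall i : 'I_q, near1 (padic_exp (eta0 i)).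
  by move=> he i; rewrite /near1 (padic_exp_sub1_norm p_gt3 (he i)) he.
apply: (near1_pow4_inj p_gt3); try by apply: near1M; exact: n1.
have ha := gibbs_measure_finite ([ffun=> a] : {ffun ball_vertices 3 1 -> 'I_q}) isT hmu hmu'.
have hb := gibbs_measure_finite ([ffun=> b] : {ffun ball_vertices 3 1 -> 'I_q}) isT hmu hmu'.
have [_ /(_ 1 isT) Z _ _ _] := hmu; have [_ /(_ 1 isT) Z' _ _ _] := hmu'.
have w0 := edge_weight_neq0 p_gt3 ([ffun=> a] : {ffun ball_vertices 3 1 -> 'I_q}) J1.
have wa := gibbs_weight_const 3 p_gt3 a J1 e1.
have wb := gibbs_weight_const 3 p_gt3 b J1 e1.
have wa' := gibbs_weight_const 3 p_gt3 a J1 e1'.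
have wb' := gibbs_weight_const 3 p_gt3 b J1 e1'.
rewrite (edge_weight_const 3 1 J b a) in wb wb'.
rewrite /gibbs_finite wa wa' in ha; rewrite /gibbs_finite wb wb' in hb.
by rewrite !exprMn; exact: cross_ratio w0 Z Z' ha hb.
Qed.

(** * Two-valued boundary laws *)

Section TwoValued.
Variables (p : nat) (p_pr : prime p) (p_gt3 : (3 < p)%N) (q : nat).
Local Notation Qp := (padic p_pr).
Local Notation nm := (@padic_norm p p_pr).
Variables (J : Qp) (J1 : nm J < 1).
Local Notation s0 := (padic_exp J - 1).

Lemma sum_two_valued (M : {set 'I_q}) (a b : Qp) :
  \sum_(i : 'I_q) (if i \in M then a else b) = #|M|%:R * a + (q%:R - #|M|%:R) * b.
Proof.
have Mq : (#|M| <= q)%N by rewrite -[leqRHS]card_ord max_card.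
rewrite (bigID (mem M)) /=; congr (_ + _).
  rewrite (eq_bigr (fun=> a)) => [|i /= ->] //; by rewrite sumr_const mulr_natl.
rewrite (eq_bigr (fun=> b)) => [|i /= /negPf ->] //.
rewrite sumr_const -natrB // mulr_natl; congr (_ *+ _).
have e : (#|M| + #|[predC M]| = q)%N by rewrite cardC card_ord.
by rewrite -[X in (X - _)%N]e addKn; apply: eq_card.
Qed.

Definition two_valued (M : {set 'I_q}) (z : Qp) (eta : 'I_q -> Qp) :=
  (forall i, nm (eta i) < 1) /\ (forall i, padic_exp (eta i) = if i \in M then z else 1).

Lemma transfer_two_valued M z eta t : two_valued M z eta ->
  transfer J eta t = s0 * (if t \in M then z else 1) + (#|M|%:R * z + (q%:R - #|M|%:R)).
Proof.
move=> [_ he]; rewrite /transfer -[X in _ + (_ + X)]mulr1 -sum_two_valued.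
rewrite (bigD1 t) //= [in RHS](bigD1 t) //= eqxx expr1 he addrA; congr (_ + _).
  by rewrite mulrBl mul1r subrK.
by apply: eq_bigr => i it; rewrite he eq_sym (negPf it) expr0 mul1r.
Qed.

(** The condition [z != 1] is what allows [M] to be recovered from the measure. *)
Definition realizes (M : {set 'I_q}) (mu : @cylinders 3 q -> Qp) :=
  exists z eta, [/\ z != 1, two_valued M z eta & gibbs_measure_of (k := 3) J (fun _ i => eta i) mu].

Lemma realizes_TIpGM (M : {set 'I_q}) mu : realizes M mu -> TIpGM (k := 3) (q := q) J mu.
Proof. by move=> [z [eta [_ _ h]]]; exists (fun _ i => eta i). Qed.

(** Two sets of fewer than q/2 spins miss a common spin [b]. Both laws are 1 at [b], so they agree
    everywhere, and each set is where its law differs from 1. *)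
Lemma realizes_inj (M M' : {set 'I_q}) mu : (#|M|.*2 < q)%N -> (#|M'|.*2 < q)%N ->
  realizes M mu -> realizes M' mu -> M = M'.
Proof.
move=> hM hM' [z [eta [z1 [e1 he] hg]]] [z' [eta' [z1' [e1' he'] hg']]].
have [b bM] : exists b, b \notin (M :|: M')%SET.
  apply/existsP; rewrite -negb_forall; apply/negP => /forallP h.
  have : (#|'I_q| <= #|(M :|: M')%SET|)%N by apply/subset_leq_card/fintype.subsetP => i _; exact: h.
  rewrite card_ord finset.cardsU; lia.
move: bM; rewrite inE negb_or => /andP[bM bM'].
have h := gibbs_measure_inj p_gt3 J1 e1 e1' hg hg'.
apply/finset.setP => a; have := h a b; rewrite !he !he' (negPf bM) (negPf bM') !mulr1.
case: (a \in M); case: (a \in M') => // e; first by rewrite e eqxx in z1.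
by rewrite -e eqxx in z1'.
Qed.

(** The equations make [transfer] equal to D x on M and D off M, so its cube is D^3 times the law.
    The first is conditional so that an empty [M] leaves [x] free. *)
Lemma realize_boundary_law (M : {set 'I_q}) (x D : Qp) : near1 x -> x ^+ 3 != 1 -> D != 0 ->
  ((0 < #|M|)%N -> s0 * x ^+ 3 + (#|M|%:R * x ^+ 3 + (q%:R - #|M|%:R)) = x * D) ->
  s0 + (#|M|%:R * x ^+ 3 + (q%:R - #|M|%:R)) = D ->
  #|M|%:R * x ^+ 4 + (q%:R - #|M|%:R) != 0 -> exists mu, realizes M mu.
Proof.
move=> x1 x3 D0 hin hout hZ.
have [eta0 eta01 eta0E] := padic_exp_surj p_gt3 (near1X 3 x1).
pose eta (i : 'I_q) := if i \in M then eta0 else 0.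
have tv : two_valued M (x ^+ 3) eta.
  split=> i; rewrite /eta; case: ifP => _ //; [by rewrite padic_norm0|exact: padic_exp0].
have tr t : transfer J eta t = D * (if t \in M then x else 1).
  rewrite (transfer_two_valued t tv); case: ifP => [tM|_].
    by rewrite hin; [rewrite mulrC|apply/card_gt0P; exists t].
  by rewrite !mulr1.
have [eta1 etaE] := tv.
have trP t : transfer J eta t ^+ 3 = D ^+ 3 * padic_exp (eta t).
  by rewrite tr exprMn etaE; case: ifP; rewrite ?expr1n.
have D3 : D ^+ 3 != 0 by rewrite expf_neq0.
have Z1 : \sum_t transfer J eta t ^+ 4 != 0.
  rewrite (_ : \sum_t _ = D ^+ 4 * (#|M|%:R * x ^+ 4 + (q%:R - #|M|%:R))) ?mulf_neq0 ?expf_neq0 //.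
  rewrite -[X in _ * (_ + X)]mulr1 -sum_two_valued mulr_sumr; apply: eq_bigr => t _.
  by rewrite tr exprMn; case: ifP; rewrite ?expr1n.
have [|||mu hmu] := @gibbs_measure_exists p p_pr 3 q J (fun _ i => eta i).
- by move=> _ i; apply/in_exp_domainE.
- by move=> n n1; apply: (partition_function_neq0 p_gt3 J1 eta1 D3).
- exact: (boundary_law_compatible p_gt3 J1 eta1 D3 trP).
by exists mu, (x ^+ 3), eta.
Qed.

Lemma realize_empty : s0 + q%:R != 0 -> (0 < q)%N -> exists mu, realizes finset.set0 mu.
Proof.
(* For empty [M] any element near 1 but different from 1 serves, and 1 + p is one. *)
move=> sq q0; have x1 : near1 (1 + p%:R : Qp).
  by rewrite /near1 addrAC subrr add0r padic_norm_nat_lt1.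
apply: (realize_boundary_law x1 _ sq); rewrite ?cards0 ?subr0 ?mul0r ?add0r //.
  apply: near1_cube_neq1 => //; rewrite -subr_eq0 addrAC subrr add0r padic_natr_eq0.
  by rewrite -lt0n prime_gt0.
by rewrite padic_natr_eq0 -lt0n.
Qed.

Lemma realize_level (M : {set 'I_q}) x : s0 != 0 -> cubic #|M|%:R s0 q%:R 1 != 0 ->
  near1 x -> cubic #|M|%:R s0 q%:R x = 0 -> #|M|%:R * x ^+ 4 + (q%:R - #|M|%:R) != 0 ->
  exists mu, realizes M mu.
Proof.
move=> s00 c1 x1 cx Z; have x3 : x ^+ 3 != 1.
  by apply: near1_cube_neq1 => //; apply: contra_neq c1 => ex; rewrite ex in cx.
have bl := cubic_boundary_law cx; apply: (@realize_boundary_law M x (#|M|%:R * x ^+ 3 + (q%:R - #|M|%:R) + s0) x1 x3 _ _ _ Z).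
(* If [D] vanished, the two equations would give s x^3 = s with s nonzero, against x^3 != 1. *)
- apply/eqP => D0; rewrite D0 mulr0 in bl; move/eqP: x3; apply; apply: (mulfI s00); rewrite mulr1.
  apply: (addIr (#|M|%:R * x ^+ 3 + (q%:R - #|M|%:R))).
  by rewrite addrA bl addrC D0.
- by move=> _; rewrite addrA bl.
by rewrite addrC.
Qed.

End TwoValued.

(** * Counting the measures *)

Lemma card_sets_by_size q (P : pred nat) :
  #|[set M : {set 'I_q} | P #|M|]%SET| = (\sum_(k < q.+1 | P k) 'C(q, k))%N.
Proof.
have Mq (M : {set 'I_q}) : (#|M| < q.+1)%N by rewrite ltnS -[leqRHS]card_ord max_card.
rewrite -sum1_card (partition_big (fun M : {set 'I_q} => Ordinal (Mq M)) P) /=; last first.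
  by move=> M; rewrite inE.
apply: eq_bigr => k Pk; rewrite sum1_card; have := card_draws 'I_q k; rewrite card_ord => <-.
apply: eq_card => M; rewrite !inE unfold_in /= inE -val_eqE /=.
by apply: andb_idl => /eqP ->.
Qed.

Theorem theorem10 (p : nat) (p_pr : prime p) (q : nat) (J : padic p_pr)
    (p_gt3 : (3 < p)%N) (q_ge2 : (2 <= q)%N)
    (J_dom : in_exp_domain J) (J_neq0 : J != 0)
    (theta_neq1 : padic_exp J != 1 - q%:R)
    (theta_neq2 : padic_exp J != 1 + q%:R / 2%:R)
    (m : nat) (m_bounds : (1 <= m <= q./2)%N)
    (m_norm : Num.max (padic_norm ((padic_exp J - 1) / m%:R))
                      (padic_norm (q%:R / m%:R : padic p_pr)) <= p%:R ^- 3) :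
  `I_(1 + 3 * 'C(q, m)) #<= (TIpGM (k := 3) (q := q) J).
Proof.
have J1 : padic_norm J < 1 by apply/in_exp_domainE.
set s0 := padic_exp J - 1.
have s01 : padic_norm s0 < 1 by rewrite padic_exp_sub1_norm.
have s00 : s0 != 0 by rewrite -padic_norm_eq0 padic_exp_sub1_norm // padic_norm_eq0.
have /andP[m0 mq2] := m_bounds.
have r_lt1 : (p%:R : rat)^-1 < 1 by rewrite invf_lt1 ?ltr0n ?ltr1n ?prime_gt0 ?prime_gt1.
have mQ0 : m%:R != 0 :> padic p_pr by rewrite padic_natr_eq0 -lt0n.
have qm : padic_norm (q%:R / m%:R : padic p_pr) <= (p%:R : rat)^-1 ^+ 3.
  by move: m_norm; rewrite ge_max exprVn => /andP[].
(* |q| = |q/m| |m| and |m| <= 1, so the bound on q/m passes to q. *)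
have p3q : (p ^ 3 %| q)%N.
  have : padic_norm (q%:R : padic p_pr) <= (p%:R : rat)^-1 ^+ 3.
    rewrite -[q%:R](divfK mQ0) padic_normM (le_trans _ qm) // ler_piMr ?padic_norm_ge0 //.
    exact: padic_norm_nat_le1.
  rewrite padic_norm_natE ?(ltnW q_ge2) // ler_iXn2l ?invr_gt0 ?ltr0n ?prime_gt0 //.
  by rewrite pfactor_dvdn // (ltnW q_ge2).
(* If 2 m = q, then q/m = 2 would be a unit, contrary to the bound. *)
have m2q : (m.*2 < q)%N.
  rewrite ltn_neqAle; apply/andP; split; last by rewrite -geq_half_double.
  apply/eqP => e; have : padic_norm (2%:R : padic p_pr) <= (p%:R : rat)^-1 ^+ 3.
    by rewrite -e -muln2 natrM mulrAC divff // mul1r in qm.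
  rewrite padic_norm_nat_unit; last by apply: prime_ndvd_lt; exact: ltnW p_gt3.
  by apply/negP; rewrite -ltNge exprn_ilt1 // invr_ge0 ler0n.
have pq : (p %| q)%N by apply: dvdn_trans p3q; rewrite dvdn_exp.
have p5 : (4 < p)%N by rewrite ltn_neqAle p_gt3 andbT; apply/eqP => p4; move: (p_pr); rewrite -p4.
pose level k := [&& 0 < k, k.*2 < q & ~~ (p %| k)]%N.
(* Sizes for which a root near 1 makes the radius-one partition function vanish. The conjunct
   [level] gives 2 k < q, which rules out the alternative i + j = q in [bad1]. *)
pose bad k := level k && `[< exists x, [/\ near1 x, cubic k%:R s0 q%:R x = 0 &
  k%:R * x ^+ 4 + (q%:R - k%:R) = 0 :> padic p_pr] >].
have c1 k : cubic k%:R s0 q%:R 1 != 0.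
  rewrite cubic1 subr_eq0; apply: contra_neq theta_neq2 => ->.
  have n2 : 2%:R != 0 :> padic p_pr by rewrite padic_natr_eq0.
  by rewrite mulrAC divff // mul1r addrC subrK.
have natI i j : i%:R = j%:R :> padic p_pr -> i = j.
  wlog ij : i j / (i <= j)%N => [h e|e].
    by case/orP: (leq_total i j) => ij; [exact: h|exact/esym/h].
  apply/eqP; rewrite eqn_leq ij /= -subn_eq0 -(padic_natr_eq0 p_pr) natrB // e subrr //.
have q0 : q%:R != 0 :> padic p_pr by rewrite padic_natr_eq0 -lt0n (ltnW q_ge2).
have bad1 i j : bad i -> bad j -> i = j.
  move=> /andP[/and3P[_ iq _] /asboolP[x [x1 cx dx]]] /andP[/and3P[_ jq _] /asboolP[y [y1 cy dy]]].
  have [/natI //|] := degenerate_level_unique_near1 p_gt3 s00 q0 x1 y1 (c1 i) cx dx cy dy.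
  by rewrite -natrD => /natI; clear -iq jq; lia.
pose good k := [&& 0 < k, k.*2 < q, ~~ (p %| k) & ~~ bad k]%N.
pose S := (finset.set0 |: [set M : {set 'I_q} | good #|M|])%SET.
have cS : (1 + 3 * 'C(q, m) <= #|S|)%N.
  rewrite cardsU1 inE cards0 card_sets_by_size leq_add2l.
  have p3 : (125 <= p ^ 3)%N by rewrite (@leq_trans (5 ^ 3)) // leq_exp2r.
  have q125 : (125 <= q)%N by exact: leq_trans p3 (dvdn_leq (ltnW q_ge2) p3q).
  (* [q.-1./2] is the largest size below q/2. An even q is a multiple of 2 p^3, so at least 250,
     which puts this size at 124 or more. *)
  apply: (@binomial_levels_ge p q q.-1./2 m bad p5 bad1); [by clear -q125; lia| |by clear -m2q; lia].
  have [qodd|qev] := boolP (odd q); [left; clear -qodd; lia|right].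
  have eq2 : q = (q.-1./2).*2.+2 by clear -q125 qev; lia.
  split; first exact: eq2.
  suff : (250 <= q)%N by clear; lia.
  have h : (p ^ 3 * 2 %| q)%N.
    rewrite Gauss_dvd ?p3q /= ?dvdn2 //; rewrite coprimeXl // coprimen2.
    by case: (even_prime p_pr) => // p2; move: p_gt3; rewrite p2.
  by apply: leq_trans (dvdn_leq (ltnW q_ge2) h); clear -p3; lia.
(* Membership stands under the existential so that [choice] yields a total function; outside [S] the
   zero function is a dummy. *)
have real M : exists mu, M \in S -> realizes J M mu.
  have [|nS] := boolP (M \in S); last by exists (fun=> 0).
  rewrite !inE => /orP[/eqP ->|gM].
    have [|mu hmu] := realize_empty p_gt3 J1 _ (ltnW q_ge2); last by exists mu.
    apply: contra_neq theta_neq1 => e.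
    by apply/eqP; rewrite -subr_eq0 opprB addrA addrAC e.
  have /and4P[M0 Mq pM nbad] := gM.
  have [x x1 cx] := cubic_root_near1 p_gt3 (padic_norm_nat_unit p_pr pM) s01
    (etrans (padic_norm_nat_lt1 p_pr q) pq).
  have [|mu hmu] := realize_level p_gt3 J1 s00 (c1 _) x1 cx; last by exists mu.
  (* A vanishing radius-one partition function would make [#|M|] a bad size. *)
  apply: contraNneq nbad => Z; rewrite /bad /level M0 Mq pM /=.
  by apply/asboolP; exists x.
have [f hf] := choice real.
have S2 M : M \in S -> (#|M|.*2 < q)%N.
  by rewrite !inE => /orP[/eqP ->|/and4P[] //]; rewrite cards0 (ltnW q_ge2).
have finj : {in S &, injective f}.
  move=> M M' MS MS' e; apply: (realizes_inj p_gt3 J1 (S2 _ MS) (S2 _ MS') (hf _ MS)).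
  by rewrite e; exact: hf.
pose g i := f (nth finset.set0 (enum S) i).
have memS i : (i < 1 + 3 * 'C(q, m))%N -> nth finset.set0 (enum S) i \in S.
  by move=> h; rewrite -mem_enum mem_nth // -cardE (leq_trans h).
have ginj : {in `I_(1 + 3 * 'C(q, m)) &, injective g}.
  move=> i j /set_mem /= hi /set_mem /= hj /(finj _ _ (memS _ hi) (memS _ hj)) /eqP.
  by rewrite nth_uniq ?enum_uniq // -?cardE ?(leq_trans hi) ?(leq_trans hj) // => /eqP.
rewrite -(card_le_eql (inj_card_eq ginj)); apply: subset_card_le => mu [i /= iN <-].
by apply: realizes_TIpGM; apply: hf; exact: memS.
Qed.
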